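(* Let $\alpha>0$ and let $(Z_i)_{i\in\mathbb{Z}}$ be an i.i.d. sequence of real random variables such that $\Pr(|Z_1|>x)=x^{-\alpha}L(x)$ for $x>0$, where $L$ is slowly varying at infinity, and $$\lim_{x\to\infty}\frac{\Pr(Z_1>x)}{\Pr(|Z_1|>x)}=p,\qquad \lim_{x\to\infty}\frac{\Pr(Z_1<-x)}{\Pr(|Z_1|>x)}=r,$$ with $p\in[0,1]$ and $p+r=1$. Let $(a_n)$ be a sequence of positive real numbers with $n\Pr(|Z_1|>a_n)\to1$ as $n\to\infty$. Fix $q\in\mathbb{N}$ and let $C_0,C_1,\dots,C_q$ be random variables such that $(C_0,\dots,C_q)$ is independent of $(Z_i)_{i\in\mathbb{Z}}$. Put $$X_t=\sum_{i=0}^{q}C_iZ_{t-i},\qquad t\in\mathbb{Z},$$ and, for $t\in[0,1]$, $$M_n(t)=\frac{1}{a_n}\bigvee_{i=1}^{\lfloor nt\rfloor}X_i\ \text{ if } t\ge \tfrac1n,\qquad M_n(t)=\frac{X_1}{a_n}\ \text{ if } t<\tfrac1n .$$ Let $C_+=\max\{C_j\vee0: j=0,\dots,q\}$ and $C_-=\max\{-C_j\vee0: j=0,\dots,q\}$. Let $$M(t)=C^{(1)}W^{(1)}(t)\vee C^{(2)}W^{(2)}(t),\qquad t\in[0,1],$$ where $W^{(1)}$ and $W^{(2)}$ are independent extremal processes with exponent measures $p\alpha x^{-\alpha-1}1_{(0,\infty)}(x)\,dx$ and $r\alpha x^{-\alpha-1}1_{(0,\infty)}(x)\,dx$ respectively,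 and $(C^{(1)},C^{(2)})$ is a random vector independent of $(W^{(1)},W^{(2)})$ with the same distribution as $(C_+,C_-)$. Then, as $n\to\infty$, $$M_n(\cdot)\xrightarrow{d}M(\cdot)$$ in $D_\uparrow[0,1]$ endowed with the Skorohod $M_1$ topology.
   Context: $a\vee b=\max\{a,b\}$; $-C_j\vee 0$ means $(-C_j)\vee 0$; $\xrightarrow{d}$ denotes convergence in distribution. $D_\uparrow[0,1]=D_\uparrow([0,1],\mathbb{R})$ is the set of non-decreasing right-continuous functions $x:[0,1]\to\mathbb{R}$ with left limits. The $M_1$ topology: for a càdlàg $x:[0,1]\to\mathbb{R}$ (with $x(0-)=x(0)$) let $\Gamma_x=\{(t,z)\in[0,1]\times\mathbb{R}: z=\lambda x(t-)+(1-\lambda)x(t)\text{ for some }\lambda\in[0,1]\}$, ordered by $(t_1,z_1)\le(t_2,z_2)$ if either $t_1<t_2$, or $t_1=t_2$ and $|x(t_1-)-z_1|\le|x(t_2-)-z_2|$. A parametric representation of $\Gamma_x$ is a continuous nondecreasing function $(\rho,u)$ mapping $[0,1]$ onto $\Gamma_x$ ($\rho$ is the time component, $u$ the spatial component); let $\Pi_s(x)$ be the set of these. The $M_1$ topology is induced by the metric $d_{M_1}(x_1,x_2)=\inf\{\sup_{s\in[0,1]}|\rho_1(s)-\rho_2(s)|\vee\sup_{s\in[0,1]}|u_1(s)-u_2(s)|:(\rho_i,u_i)\in\Pi_s(x_i),\,i=1,2\}$. An extremal process with exponent measure $\nu$ on $(0,\infty)$ is a process with the law of $t\mapsto\bigvee_{t_i\le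 t}j_i$, $t\in[0,1]$ (with $\bigvee\emptyset=0$), where $\sum_i\delta_{(t_i,j_i)}$ is a Poisson point process on $[0,1]\times(0,\infty)$ with intensity measure $\mathrm{Leb}\times\nu$. Convention: if $p=0$ then $W^{(1)}$ is the zero process, and if $r=0$ then $W^{(2)}$ is the zero process. *)

(* Defs.v *)
From HB Require Import structures.
From mathcomp Require Import all_boot all_order all_algebra finmap archimedean.
From mathcomp Require Import all_classical all_reals all_analysis measurable_realfun.

Set Implicit Arguments.
Unset Strict Implicit.
Unset Printing Implicit Defensive.

Import Order.TTheory GRing.Theory Num.Theory.
Import numFieldNormedType.Exports.

Local Open Scope classical_set_scope.
Local Open Scope ring_scope.

(** * The space D_up[0,1] with the Skorohod M1 topology

    A path on [0,1] is represented by a total function on [R]; only its values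
    on [0,1] are ever used.  Hence two elements of [Dup R] may agree on [0,1]
    without being equal; they are then topologically indistinguishable. *)

Definition nondecreasing_cadlag (R : realType) (x : R -> R) : Prop :=
  [/\ {in `[0, 1]%R &, {homo x : s t / s <= t}},
      forall t, 0 <= t < 1 -> x s @[s --> t^'+] --> x t &
      forall t, 0 < t <= 1 -> cvg (x s @[s --> t^'-])].

Record Dup (R : realType) := MkDup {
  Dup_fun :> R -> R ;
  Dup_funP : nondecreasing_cadlag Dup_fun }.

Lemma nondecreasing_cadlag0 (R : realType) :
  nondecreasing_cadlag (fun _ : R => 0 : R).
Proof.
split=> // [t _|t _]; first exact: cvg_cst.
by apply/cvg_ex; exists 0; exact: cvg_cst.
Qed.

(* Bundles a path; the zero path is a default for functions that are not in
   D_up[0,1].  See [nondecreasing_cadlag_partial_max] and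
   [nondecreasing_cadlag_max] for the paths this is applied to. *)
Definition Dup_of (R : realType) (x : R -> R) : Dup R :=
  if pselect (nondecreasing_cadlag x) is left xP then MkDup xP
  else MkDup (nondecreasing_cadlag0 R).

(* x(t-), with x(0-) = x(0) *)
Definition left_lim (R : realType) (x : R -> R) (t : R) : R :=
  if t == 0 then x 0 else lim (x s @[s --> t^'-]).

Definition completed_graph (R : realType) (x : R -> R) : set (R * R) :=
  [set tz | 0 <= tz.1 <= 1 /\
     exists2 l : R, 0 <= l <= 1 &
       tz.2 = l * left_lim x tz.1 + (1 - l) * x tz.1].

Definition graph_le (R : realType) (x : R -> R) (a b : R * R) : Prop :=
  a.1 < b.1 \/
  (a.1 = b.1 /\ `|left_lim x a.1 - a.2| <= `|left_lim x b.1 - b.2|).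

(* [g s = (rho s, u s)] *)
Definition parametric_repr (R : realType) (x : R -> R) (g : R -> R * R) : Prop :=
  [/\ {within `[0, 1], continuous g},
      forall s1 s2, 0 <= s1 -> s1 <= s2 -> s2 <= 1 ->
        graph_le x (g s1) (g s2) &
      g @` `[0, 1] = completed_graph x].

(* Extended-real valued only because the infimum and the suprema are taken in
   [\bar R]. *)
Definition dM1 (R : realType) (x1 x2 : R -> R) : \bar R :=
  ereal_inf [set e : \bar R | exists g1 g2 : R -> R * R,
    [/\ parametric_repr x1 g1, parametric_repr x2 g2 &
        e = maxe
          (ereal_sup [set (`|(g1 s).1 - (g2 s).1|)%:E | s in `[0, 1]])
          (ereal_sup [set (`|(g1 s).2 - (g2 s).2|)%:E | s in `[0, 1]])]].

Definition M1_open (R : realType) : set_system (Dup R) :=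
  [set U | forall x : Dup R, U x ->
     exists2 e : R, 0 < e & forall y : Dup R, (dM1 x y < e%:E)%E -> U y].

Section M1_topology.
Context (R : realType).

Let M1_openT : M1_open [set: Dup R].
Proof. by move=> x _; exists 1. Qed.

Let M1_openI : setI_closed (@M1_open R).
Proof.
move=> A B oA oB x [/oA[e1 e1_gt0 h1] /oB[e2 e2_gt0 h2]].
exists (Num.min e1 e2); first by rewrite lt_min e1_gt0.
move=> y; rewrite EFin_min lt_min => /andP[d1 d2].
by split; [exact: h1|exact: h2].
Qed.

Let M1_open_bigU (I : Type) (f : I -> set (Dup R)) :
  (forall i, M1_open (f i)) -> M1_open (\bigcup_i f i).
Proof.
move=> of_ x [i _ /of_[e e_gt0 h]].
by exists e => // y /h fy; exists i.
Qed.

HB.instance Definition _ := gen_eqMixin (Dup R).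
HB.instance Definition _ := gen_choiceMixin (Dup R).
HB.instance Definition _ :=
  isOpenTopological.Build (Dup R) M1_openT M1_openI M1_open_bigU.

End M1_topology.

(** * Probability *)

(* [X] is measurable for the Borel sigma-algebra of [E]. *)
Definition random_element d (T : measurableType d) (E : topologicalType)
    (X : T -> E) : Prop :=
  forall A : set E, <<s @open E >> A -> measurable (X @^-1` A).

Definition cvg_in_distribution d d' (T : measurableType d)
    (T' : measurableType d') (R : realType) (P : probability T R)
    (P' : probability T' R) (E : topologicalType)
    (X : nat -> T -> E) (Y : T' -> E) : Prop :=
  [/\ forall n, random_element (X n), random_element Y &
      forall f : E -> R, continuous f ->
        (exists K : R, forall x, `|f x| <= K) ->
        ('E_P[f \o X n] @[n --> \oo] --> 'E_P'[f \o Y])%E].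

Definition mutually_independent d d' (T : measurableType d)
    (E : measurableType d') (R : realType) (P : probability T R)
    (I : choiceType) (X : I -> T -> E) : Prop :=
  forall (J : {fset I}) (B : I -> set E), (forall i, measurable (B i)) ->
    P (\bigcap_(i in [set` J]) (X i @^-1` B i)) =
    (\prod_(i <- J) P (X i @^-1` B i))%E.

Definition identically_distributed d (T : measurableType d) (R : realType)
    (P : probability T R) (I : Type) (X : I -> T -> R) : Prop :=
  forall (i j : I) (B : set R), measurable B ->
    P (X i @^-1` B) = P (X j @^-1` B).

Definition sigma_generated d (T : measurableType d) (R : realType)
    (F : set (T -> R)) : set_system T :=
  <<s [set A | exists2 f, F f & preimage_set_system setT f measurable A] >>.

(* Independence of two (jointly taken) families of real random variables *)
Definition independent_families d (T : measurableType d) (R : realType)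
    (P : probability T R) (F G : set (T -> R)) : Prop :=
  forall A B, sigma_generated F A -> sigma_generated G B ->
    P (A `&` B) = (P A * P B)%E.

Definition coordinates d (T : measurableType d) (R : realType)
    (W : T -> Dup R) : set (T -> R) :=
  [set f | exists2 t : R, 0 <= t <= 1 & f = fun w => W w t].

(* Equality of the finite-dimensional distributions on the index set [D] *)
Definition same_process_law d d' de (T : measurableType d)
    (T' : measurableType d') (E : measurableType de) (R : realType)
    (P : probability T R) (P' : probability T' R)
    (I : choiceType) (D : set I) (X : I -> T -> E) (Y : I -> T' -> E) : Prop :=
  forall (J : {fset I}) (B : I -> set E), [set` J] `<=` D ->
    (forall i, measurable (B i)) ->
    P (\bigcap_(i in [set` J]) (X i @^-1` B i)) =
    P' (\bigcap_(i in [set` J]) (Y i @^-1` B i)).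

(** * Extremal processes

    A point process with at most countably many points (t_i, j_i) is a sequence
    of [option]s; the indices [i] with [pts i w = None] carry no point, so the
    number of points may be finite and random. *)

Definition point_count (T : Type) {R : realType} (S : Type)
    (pts : nat -> T -> option S) (B : set S) (w : T) : \bar R :=
  counting [set i | exists2 z, pts i w = Some z & B z].

(* Poisson point process on [E] with intensity measure [mu] *)
Definition poisson_point_process d ds (T : measurableType d)
    (S : measurableType ds) (R : realType) (P : probability T R) (E : set S)
    (mu : set S -> \bar R) (pts : nat -> T -> option S) : Prop :=
  [/\ forall i w z, pts i w = Some z -> E z,
      forall B, measurable B -> B `<=` E ->
        measurable_fun setT (point_count pts B : T -> \bar R),
      forall B, measurable B -> B `<=` E -> (mu B < +oo)%E ->
        forall k : nat, P [set w | point_count pts B w = (k%:R : R)%:E] =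
          poisson_prob (fine (mu B)) k [set k],
      forall B, measurable B -> B `<=` E -> mu B = +oo%E ->
        P [set w | point_count pts B w = +oo%E :> \bar R] = 1%E &
      forall (m : nat) (B : 'I_m -> set S),
        (forall i, measurable (B i) /\ B i `<=` E) -> trivIset setT B ->
        mutually_independent P
          (fun i => point_count pts (B i) : T -> \bar R)].

Definition running_sup (T : Type) (R : realType)
    (pts : nat -> T -> option (R * R)) (t : R) (w : T) : \bar R :=
  ereal_sup ([set (0 : R)%:E] `|` [set j%:E | j in [set j | exists i s,
    pts i w = Some (s, j) /\ s <= t]]).

Definition extremal_process d (T : measurableType d) (R : realType)
    (P : probability T R) (nu : set R -> \bar R) (W : T -> Dup R) : Prop :=
  (forall t, 0 <= t <= 1 -> measurable_fun setT (fun w => W w t)) /\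
  exists (d0 : measure_display) (T0 : measurableType d0)
         (P0 : probability T0 R) (pts : nat -> T0 -> option (R * R)),
    poisson_point_process P0 (`[0, 1] `*` `]0, +oo[ : set (R * R))
      (@lebesgue_measure R \x nu)%E pts /\
    same_process_law P P0 `[0, 1]
      (fun t w => (W w t)%:E) (running_sup pts).

(* The measure c * alpha * x^(-alpha-1) 1_(0,oo)(x) dx *)
Definition power_measure (R : realType) (c alpha : R) (B : set R) : \bar R :=
  (\int[lebesgue_measure]_(x in B)
     (c * alpha * x `^ (- alpha - 1) * \1_`]0, +oo[ x)%:E)%E.

(** * Moving averages with random coefficients and their partial maxima *)

Definition slowly_varying (R : realType) (L : R -> R) : Prop :=
  [/\ measurable_fun (`]0, +oo[ : set R) L,
      forall x, 0 < x -> 0 < L x &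
      forall c, 0 < c -> L (c * x) / L x @[x --> +oo] --> (1 : R)].

Definition linear_process (T : Type) (R : realType) (q : nat)
    (C : 'I_q.+1 -> T -> R) (Z : int -> T -> R) (t : int) (w : T) : R :=
  \sum_(i < q.+1) C i w * Z (t - (i : nat)%:Z) w.

(* For t >= 1/n the seed [x 1] of the iterated maximum is one of its terms. *)
Definition partial_max (R : realType) (a : R) (x : int -> R) (n : nat) (t : R)
    : R :=
  if n%:R^-1 <= t then
    a^-1 * \big[Num.max/x 1]_(1 <= i < (Num.truncn (n%:R * t)).+1) x i%:Z
  else x 1 / a.

Lemma cvg_maxr (R : realType) (F : set_system R) {FF : Filter F}
    (f g : R -> R) (a b : R) :
  f @ F --> a -> g @ F --> b ->
  (fun s => Num.max (f s) (g s)) @ F --> Num.max a b.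
Proof.
move=> fa gb; rewrite maxr_absE; under eq_fun do rewrite maxr_absE.
apply: cvgM; last exact: cvg_cst.
by apply: cvgD; [exact: cvgD|apply: cvg_norm; exact: cvgB].
Qed.

Lemma nondecreasing_cadlag_max (R : realType) (c1 c2 : R) (w1 w2 : Dup R) :
  0 <= c1 -> 0 <= c2 ->
  nondecreasing_cadlag (fun t => Num.max (c1 * w1 t) (c2 * w2 t)).
Proof.
case: w1 w2 => [x [xnd xr xl]] [y [ynd yr yl]] /= c1_ge0 c2_ge0; split.
- move=> s t s01 t01 st; rewrite ge_max !le_max.
  by rewrite ler_wpM2l ?xnd//= ler_wpM2l ?orbT ?ynd.
- by move=> t t01; apply: cvg_maxr; apply: cvgM; [exact: cvg_cst|exact: xr|exact: cvg_cst|exact: yr].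
- move=> t t01; apply/cvg_ex.
  have /cvg_ex[a xa] := xl _ t01; have /cvg_ex[b yb] := yl _ t01.
  by exists (Num.max (c1 * a) (c2 * b)); apply: cvg_maxr; apply: cvgM; rewrite //; exact: cvg_cst.
Qed.

Lemma nondecreasing_cadlag_partial_max (R : realType) (a : R) (x : int -> R)
    (n : nat) : 0 < a -> nondecreasing_cadlag (partial_max a x n).
Proof.
move=> a_gt0.
pose G (k : nat) := \big[Num.max/x 1]_(1 <= i < k.+1) x i%:Z.
have G_nd : {homo G : k m / (k <= m)%N >-> k <= m}.
  by move=> k m km; exact: le_bigmax_nat.
have [->|n_gt0] := posnP n.
  have E t : 0 <= t -> partial_max a x 0 t = a^-1 * G 0%N.
    by move=> t0; rewrite /partial_max invr0 t0 mul0r truncn0.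
  split.
  - move=> s t; rewrite !in_itv/= => /andP[s0 _] /andP[t0 _] _.
    by rewrite !E.
  - move=> t /andP[t0 t1]; rewrite E//.
    apply: cvg_near_cst; near=> s; rewrite E//.
    by apply: (le_trans t0); near: s; exact: nbhs_right_ge.
  - move=> t /andP[t0 t1]; apply/cvg_ex; exists (a^-1 * G 0%N).
    apply: cvg_near_cst; near=> s; rewrite E//.
    by near: s; exact: nbhs_left_ge.
have n0 : 0 < n%:R :> R by rewrite ltr0n.
have E t : 0 <= t -> partial_max a x n t = a^-1 * G (Num.truncn (n%:R * t)).
  move=> t0; rewrite /partial_max; case: ifPn => //; rewrite -ltNge => tn.
  suff -> : Num.truncn (n%:R * t) = 0%N by rewrite /G big_geq// mulrC.
  apply: truncn_def; rewrite mulr_ge0//=.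
  by rewrite mulrC -ltr_pdivlMr// mul1r.
split.
- move=> s t; rewrite !in_itv/= => /andP[s0 _] /andP[t0 _] st.
  rewrite !E// ler_pM2l ?invr_gt0//; apply: G_nd.
  by apply: le_truncn; rewrite ler_pM2l.
- move=> t /andP[t0 t1]; rewrite E//.
  have nt0 : 0 <= n%:R * t by rewrite mulr_ge0// ltW.
  have /andP[h1 h2] := truncn_itv nt0.
  apply: cvg_near_cst; near=> s.
  have ts : t <= s by near: s; exact: nbhs_right_ge.
  rewrite E ?(le_trans t0)//; congr (_ * G _).
  apply: truncn_def; rewrite (le_trans h1) ?ler_pM2l//=.
  rewrite mulrC -ltr_pdivlMr//; near: s; apply: nbhs_right_lt.
  by rewrite ltr_pdivlMr// mulrC.
- move=> t /andP[t0 t1]; apply/cvg_ex.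
  have nt0 : 0 < n%:R * t by rewrite mulr_gt0.
  pose k := (Num.ceil (n%:R * t) - 1)%R.
  have k0 : 0 <= k by rewrite subr_ge0 -gtz0_ge1 ceil_gt0.
  exists (a^-1 * G `|k|%N); apply: cvg_near_cst; near=> s.
  have st : s < t by near: s; exact: nbhs_left_lt.
  have ks : (`|k|%N)%:R <= n%:R * s.
    rewrite mulrC -ler_pdivrMr//; near: s; apply: nbhs_left_ge.
    rewrite ltr_pdivrMr// mulrC natr_absz ger0_norm// /k.
    by rewrite -ceil_gt_int ltrBlDr ltrDl.
  have s0 : 0 <= s by rewrite -(pmulr_rge0 _ n0) (le_trans _ ks).
  rewrite E//; congr (_ * G _); apply: truncn_def; rewrite ks/=.
  have -> : (`|k|.+1)%:R = (k + 1)%:~R :> R.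
    by rewrite -natr1 natr_absz ger0_norm// intrD.
  rewrite /k subrK (@lt_le_trans _ _ (n%:R * t)) ?ltr_pM2l//.
  exact: ceil_ge.
Unshelve. all: by end_near.
Qed.

(* Main.v *)
Require Import Defs.
From mathcomp Require Import all_boot all_order all_algebra finmap archimedean.
From mathcomp Require Import all_classical all_reals all_analysis measurable_realfun.
From mathcomp Require Import zify ring lra.

Set Implicit Arguments.
Unset Strict Implicit.
Unset Printing Implicit Defensive.

Import Order.TTheory GRing.Theory Num.Theory.
Import numFieldNormedType.Exports.

Local Open Scope classical_set_scope.
Local Open Scope ring_scope.

(** Why the theorem holds.

    Topology. A nondecreasing path is known up to a small M1 distance from its
    values on a fine grid: parametrising the completed graph by the diagonal
    coordinate [t + z] makes all components 1-Lipschitz, and a Levy-type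
    comparison of two monotone paths bounds the distance of these
    parametrisations ([dM1_grid]). Hence every M1-open set is exhausted by sets
    of paths whose grid values lie in open sets of vectors
    ([M1_open_grid_core]). This yields measurability of the random paths from
    measurability of their coordinates, and it reduces weak convergence to lower
    bounds for the probabilities of open sets of grid values
    ([M1_open_liminf], [cvg_expectation_open]).

    One large innovation. With probability tending to one, no two innovations
    above a small multiple of [a n] are within distance [q], and none is near
    time one or near a grid time. Then every moving sum consists of at most one
    relevant term, and the partial maximum up to a grid time is, up to a small
    multiple of the total weight of the coefficients, the maximum of [C_+] times
    the largest innovation and [C_-] times the largest negated innovation
    ([moving_max_near], [scaled_max_approx]). The total weight is random but
    tight.

    Limit law. It remains to treat the vector made of [C_+], [C_-] and the two
    families of normalised extremes at the grid times. Its orthant probabilities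
    factorise, since the coefficients are independent of the innovations. Those
    of the extremes are products over blocks of indices of large powers of
    probabilities close to one, with exponential limits by regular variation
    ([prob_extremes_cvg]). The same exponentials are the void probabilities of
    the Poisson processes behind the two extremal processes ([extremal_cdf]).
    Orthants form a pi-system from which half-open boxes are obtained by finite
    set operations, so convergence of their probabilities gives the lower bounds
    for open sets ([prob_box_open_liminf], [decoupled_liminf]). *)

(** * Diagonal parametrisation of the completed graph *)

Section path_parametrisation.
Context {R : realType}.
Implicit Types (x y : Dup R) (s t : R).

Lemma Dup_homo x s t : 0 <= s -> s <= t -> t <= 1 -> x s <= x t.
Proof.
case: x => f [fnd _ _] /= s0 st t1.
by apply: fnd; rewrite // in_itv/= ?s0 ?t1 ?(le_trans s0 st) ?(le_trans st t1).
Qed.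

Lemma Dup_near_left (t : R) (u : R) : u < t -> \forall s \near t^'-, u <= s <= t.
Proof.
move=> ut; near=> s; apply/andP; split.
  by near: s; exact: nbhs_left_ge.
by near: s; exact: nbhs_left_le.
Unshelve. all: by end_near. Qed.

Lemma left_lim_ge x s t : 0 <= s -> s < t -> t <= 1 -> x s <= left_lim x t.
Proof.
move=> s0 st t1; have t0 : 0 < t by exact: le_lt_trans st.
rewrite /left_lim gt_eqF//; apply: limr_ge.
  by case: x => f [_ _ fl]/=; apply: fl; rewrite t0.
near=> u; have /andP[su ut] : s <= u <= t by near: u; exact: Dup_near_left.
by apply: Dup_homo => //; exact: le_trans t1.
Unshelve. all: by end_near. Qed.

Lemma left_lim_le_at x t c : 0 < t -> t <= 1 ->
  (forall s, 0 <= s -> s < t -> x s <= c + (t - s)) -> left_lim x t <= c.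
Proof.
move=> t0 t1 xc; rewrite /left_lim gt_eqF//.
apply/ler_addgt0Pr => e e0; apply: limr_le.
  by case: x xc => f [_ _ fl]/= _; apply: fl; rewrite t0.
near=> s; have s0 : 0 <= s by near: s; exact: nbhs_left_ge.
have st : s < t by near: s; exact: nbhs_left_lt.
apply: (le_trans (xc _ s0 st)); rewrite lerD2l lerBlDr -lerBlDl.
by near: s; apply: nbhs_left_ge; rewrite ltrBlDr ltrDl.
Unshelve. all: by end_near. Qed.

Lemma left_lim_le x t : 0 <= t -> t <= 1 -> left_lim x t <= x t.
Proof.
rewrite le_eqVlt => /predU1P[<- _|t0 t1]; first by rewrite /left_lim eqxx.
apply: left_lim_le_at => // s s0 st; apply: (le_trans (Dup_homo _ s0 (ltW st) t1)).
by rewrite lerDl subr_ge0 ltW.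
Qed.

(** In the rotated coordinate [t + z] the completed graph of a nondecreasing path
    is the graph of a function, and both components are 1-Lipschitz in it. The
    parameter [s] runs linearly through the range [x 0, 1 + x 1] of [t + z]. *)
Definition diag_level x s : R := x 0 + s * (1 + x 1 - x 0).

(** The time of the point of the completed graph with [t + z = diag_level x s]. *)
Definition diag_time x s : R :=
  sup [set t | 0 <= t <= 1 /\ t + x t <= diag_level x s].

Definition diag_param x s : R * R := (diag_time x s, diag_level x s - diag_time x s).

Let Dup01 x : 0 < 1 + x 1 - x 0.
Proof. by rewrite -addrA ltr_wpDr// subr_ge0 Dup_homo. Qed.

Lemma diag_level_ge x s : 0 <= s -> x 0 <= diag_level x s.
Proof. by move=> s0; rewrite lerDl mulr_ge0// ltW. Qed.

Lemma diag_level_le x s : s <= 1 -> diag_level x s <= 1 + x 1.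
Proof.
move=> s1; rewrite /diag_level -lerBrDl -[leRHS]mul1r ler_wpM2r// ltW//.
Qed.

Let nonempty x s : 0 <= s ->
  [set t | 0 <= t <= 1 /\ t + x t <= diag_level x s] 0.
Proof. by move=> s0 /=; rewrite lexx ler01 add0r; split=> //; exact: diag_level_ge. Qed.

Let bounded x s : ubound [set t | 0 <= t <= 1 /\ t + x t <= diag_level x s] 1.
Proof. by move=> t/= [/andP[]]. Qed.

Lemma diag_time_ge x s t : 0 <= t <= 1 -> t + x t <= diag_level x s ->
  t <= diag_time x s.
Proof. by move=> t01 h; apply: ub_le_sup => //; exists 1; exact: bounded. Qed.

Lemma diag_time_le x s c : 0 <= s ->
  (forall t, 0 <= t <= 1 -> t + x t <= diag_level x s -> t <= c) ->
  diag_time x s <= c.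
Proof.
move=> s0 h; apply: ge_sup; first by exists 0; exact: nonempty.
by move=> t/= [? ?]; exact: h.
Qed.

Lemma diag_time01 x s : 0 <= s -> 0 <= diag_time x s <= 1.
Proof.
move=> s0; apply/andP; split; last by apply: diag_time_le => // t /andP[].
by apply: diag_time_ge; rewrite ?lexx ?ler01// add0r diag_level_ge.
Qed.

Lemma diag_time_lt x s t : 0 <= s -> 0 <= t -> t < diag_time x s ->
  t + x t <= diag_level x s.
Proof.
move=> s0 t0 tr; have /sup_gt : t < sup [set t | 0 <= t <= 1 /\ t + x t <= diag_level x s] by [].
case; first by exists 0; exact: nonempty.
move=> u [/andP[u0 u1] xu] tu; apply: le_trans xu.
by apply: lerD; [exact: ltW|apply: Dup_homo => //; exact: ltW].
Qed.

(** Together with [diag_param_le] this places the point on the completed graph: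
    the inequality [t + x t <= diag_level x s], valid for [t] below the supremum,
    passes to the left limit. *)
Lemma diag_param_ge x s : 0 <= s -> left_lim x (diag_time x s) <= (diag_param x s).2.
Proof.
move=> s0; have /andP[r0 r1] := diag_time01 x s0.
move: r0; rewrite le_eqVlt => /predU1P[r0|r0].
  by rewrite /diag_param/= -r0 /left_lim eqxx subr0 diag_level_ge.
apply: left_lim_le_at => // t t0 tr; have := diag_time_lt s0 t0 tr.
by rewrite /=; lra.
Qed.

Lemma diag_param_le x s : 0 <= s <= 1 -> (diag_param x s).2 <= x (diag_time x s).
Proof.
move=> /andP[s0 s1]; have /andP[r0 r1] := diag_time01 x s0.
rewrite /=; set r := diag_time x s in r0 r1 *.
move: r1; rewrite le_eqVlt => /predU1P[r1|r1].
  by rewrite r1; have := diag_level_le x s1; lra.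
have xr : x u @[u --> r^'+] --> x r.
  by case: (x) => f [_ fr _] /=; apply: fr; rewrite r0.
have cr : diag_level x s - u @[u --> r^'+] --> diag_level x s - r.
  by apply: cvgB; [exact: cvg_cst|exact: cvg_at_right_filter].
apply: (ler_cvg_to cr xr); near=> u.
have ru : r < u by near: u; exact: nbhs_right_gt.
have u1 : u <= 1 by near: u; exact: nbhs_right_le.
rewrite leNgt; apply/negP => h; move: ru; apply/negP; rewrite -leNgt.
have u0 : 0 <= u by apply: (le_trans r0); near: u; exact: nbhs_right_ge.
by apply: diag_time_ge; [rewrite u0|lra].
Unshelve. all: by end_near. Qed.

(** Lowering a time [t] by [e] lowers [t + x t] by at least [e], since the path is
    monotone; hence the supremum moves by at most the change of level. *)
Lemma diag_time_homo x s1 s2 : 0 <= s1 -> s1 <= s2 ->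
  diag_time x s1 <= diag_time x s2 <= diag_time x s1 + (diag_level x s2 - diag_level x s1).
Proof.
move=> s10 s12; have le12 : diag_level x s1 <= diag_level x s2.
  by rewrite lerD2l ler_wpM2r// ltW.
have s20 : 0 <= s2 by exact: le_trans s12.
apply/andP; split.
  by apply: diag_time_le => // t t01 h; apply: diag_time_ge => //; exact: le_trans le12.
apply: diag_time_le => // t /andP[t0 t1] h.
have [e ee] : exists e, diag_level x s2 - diag_level x s1 = e by exists (diag_level x s2 - diag_level x s1).
rewrite ee; have e0 : 0 <= e by rewrite -ee subr_ge0.
have [te|te] := ltP t e; first by rewrite ltW// (lt_le_trans te)// lerDr; have /andP[] := diag_time01 x s10.
rewrite -lerBlDr; apply: diag_time_ge; first by lra.
have : x (t - e) <= x t by apply: Dup_homo; lra.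
lra.
Qed.

(** A level determines its point on the completed graph, because [t + z] strictly
    increases along it; this gives surjectivity of the parametrisation. *)
Lemma diag_timeE x s t z : 0 <= s -> 0 <= t <= 1 ->
  left_lim x t <= z <= x t -> diag_level x s = t + z -> diag_time x s = t.
Proof.
move=> s0 /andP[t0 t1] /andP[zl zr] st; apply/eqP; rewrite eq_le; apply/andP; split.
  apply: diag_time_le => // u /andP[u0 u1]; rewrite st => h.
  rewrite leNgt; apply/negP => tu.
  by have := Dup_homo x t0 (ltW tu) u1; lra.
apply/ler_addgt0Pr => e e0; have [te|te] := leP t e.
  by rewrite (le_trans te)// lerDr; have /andP[] := diag_time01 x s0.
rewrite -lerBlDr; apply: diag_time_ge; first by lra.
have : x (t - e) <= left_lim x t by apply: left_lim_ge => //; lra.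
by rewrite st; lra.
Qed.

Lemma diag_time_lipschitz x s1 s2 : 0 <= s1 -> 0 <= s2 ->
  `|diag_time x s1 - diag_time x s2| <= `|s1 - s2| * (1 + x 1 - x 0).
Proof.
wlog s12 : s1 s2 / s1 <= s2.
  move=> h s10 s20; have [/h->//|/ltW/h h'] := leP s1 s2.
  by rewrite (distrC (diag_time x s1)) (distrC s1) h'.
move=> s10 s20; have /andP[h1 h2] := diag_time_homo x s10 s12.
rewrite (distrC (diag_time x s1)) (distrC s1) !ger0_norm ?subr_ge0//.
rewrite lerBlDl (le_trans h2)// lerD2l /diag_level; lra.
Qed.

Lemma diag_param_continuous x : {within `[0, 1], continuous (diag_param x)}.
Proof.
have tc : {within `[0, 1], continuous (diag_time x)}.
  apply/subspace_continuousP => s; rewrite /= in_itv/= => /andP[s0 s1].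
  apply/cvgrPdist_le => e e0; have K0 := Dup01 x; rewrite near_withinE; near=> u.
  rewrite /= in_itv/= => /andP[u0 u1].
  apply: (le_trans (diag_time_lipschitz _ s0 u0)); rewrite -ler_pdivlMr// ltW//.
  near: u; have e'0 : 0 < e / (1 + x 1 - x 0) by exact: divr_gt0.
  by have /cvgrPdist_lt := @cvg_id _ (nbhs s); apply.
have lc : {within `[0, 1], continuous (diag_level x)}.
  apply: continuous_subspaceT => s; apply: cvgD; first exact: cvg_cst.
  by apply: cvgM; [exact: cvg_id|exact: cvg_cst].
by move=> s; exact: (cvg_pair (tc s) (cvgB (lc s) (tc s))).
Unshelve. all: by end_near. Qed.

Lemma diag_paramP x : parametric_repr x (diag_param x).
Proof.
split; first exact: diag_param_continuous.
  move=> s1 s2 s10 s12 s21; have s20 := le_trans s10 s12.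
  have /andP[tle _] := diag_time_homo x s10 s12; rewrite /graph_le/=.
  move: tle; rewrite le_eqVlt => /predU1P[te|]; last by left.
  right; split=> //; have := diag_param_ge x s20; have := diag_param_ge x s10.
  rewrite /= te => h1 h2; rewrite !ler0_norm ?subr_le0// lerN2 lerD2l lerN2 lerD2r.
  by rewrite lerD2l ler_wpM2r// ltW.
apply/seteqP; split=> [_ [s + <-]|[t z]].
  rewrite /= in_itv/= => s01; have /andP[s0 s1] := s01.
  split; first exact: diag_time01.
  have := diag_param_ge x s0; have := diag_param_le x s01 => /=.
  set r := diag_time x s; set u := diag_level x s - r => ur lu.
  have [e|ne] := eqVneq (left_lim x r) (x r).
    exists 0; rewrite ?lexx ?ler01// mul0r add0r subr0 mul1r.
    by apply/eqP; rewrite eq_le ur -e lu.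
  have lr : 0 < x r - left_lim x r.
    by rewrite subr_gt0 lt_neqAle ne/= (le_trans lu ur).
  exists ((x r - u) / (x r - left_lim x r)).
    rewrite divr_ge0 ?(ltW lr) ?subr_ge0//= ler_pdivrMr// mul1r.
    by rewrite lerD2l lerN2.
  by field; rewrite gt_eqF.
rewrite /completed_graph/= => -[t01 [l l01 zE]].
have /andP[t0 t1] := t01; have ltt := left_lim_le x t0 t1.
have lz : left_lim x t <= z <= x t.
  by case/andP: l01 => l0 l1; rewrite zE; apply/andP; split; nra.
have K0 := Dup01 x.
have x0l : x 0 <= left_lim x t.
  move: t0; rewrite le_eqVlt => /predU1P[<-|t0]; first by rewrite /left_lim eqxx.
  exact: left_lim_ge.
have xt1 : x t <= x 1 by exact: Dup_homo.
have lvl : diag_level x ((t + z - x 0) / (1 + x 1 - x 0)) = t + z.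
  by rewrite /diag_level; field; rewrite gt_eqF.
have s0 : 0 <= (t + z - x 0) / (1 + x 1 - x 0).
  by rewrite divr_ge0 ?(ltW K0)//; case/andP: lz; lra.
exists ((t + z - x 0) / (1 + x 1 - x 0)).
  by rewrite /= in_itv/= s0/= ler_pdivrMr// mul1r; case/andP: lz; lra.
rewrite /diag_param (diag_timeE s0 t01 lz lvl) lvl; congr pair; ring.
Qed.

(** Between two neighbouring grid points a monotone path is controlled by its
    values at these points, up to a time shift of one mesh. *)
Lemma grid_levy (m : nat) (e : R) x y : m.+1%:R^-1 <= e ->
  (forall l : 'I_m.+2, `|x (l%:R / m.+1%:R) - y (l%:R / m.+1%:R)| <= e) ->
  forall t, t <= 1 -> e <= t -> y (t - e) <= x t + e.
Proof.
move=> me xy t t1 et; have m0 : 0 < m.+1%:R :> R by rewrite ltr0n.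
have t0 : 0 <= t by rewrite (le_trans _ et)// (le_trans _ me).
have /andP[l1 l2] := @truncn_itv R (m.+1%:R * t) (mulr_ge0 (ltW m0) t0).
set l := Num.truncn _ in l1 l2.
have lm : (l < m.+2)%N.
  by rewrite ltnS -(ler_nat R) (le_trans l1)// -[leRHS]mulr1 ler_wpM2l// ltW.
have h1 : l%:R / m.+1%:R <= t by rewrite ler_pdivrMr// mulrC.
have h2 : t - e <= l%:R / m.+1%:R.
  rewrite lerBlDr (le_trans _ (lerD (lexx _) me))// -[X in _ + X]mul1r -mulrDl.
  by rewrite natr1 ler_pdivlMr// mulrC ltW.
have := xy (Ordinal lm) => /=; rewrite ler_norml => /andP[h3 h4].
have h5 : y (t - e) <= y (l%:R / m.+1%:R).
  by apply: Dup_homo => //; [rewrite subr_ge0|exact: le_trans t1].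
have h6 : x (l%:R / m.+1%:R) <= x t.
  by apply: Dup_homo => //; rewrite divr_ge0// ltW.
lra.
Qed.

(** One [e] of the shift compensates for the spatial error and one for the
    difference of the levels. *)
Lemma diag_time_levy (e : R) x y s : 0 <= e -> 0 <= s ->
  diag_level x s <= diag_level y s + e ->
  (forall t, t <= 1 -> e <= t -> y (t - e) <= x t + e) ->
  diag_time x s <= diag_time y s + 2 * e.
Proof.
move=> e0 s0 lxy levy; apply: diag_time_le => // t /andP[t0 t1] xt.
have [te|te] := leP t (2 * e).
  by rewrite (le_trans te)// lerDr; have /andP[] := diag_time01 y s0.
rewrite -lerBlDr; apply: diag_time_ge; first by apply/andP; split; lra.
have h1 : y (t - 2 * e) <= y (t - e) by apply: Dup_homo; lra.
have h2 := levy t t1; lra.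
Qed.

(** Parametrising both graphs by their diagonal level reduces the distance in
    both coordinates to a Levy-type comparison of the paths, and for monotone
    paths a finite grid suffices for such a comparison. *)
Lemma dM1_grid (m : nat) (e : R) x y : m.+1%:R^-1 <= e ->
  (forall l : 'I_m.+2, `|x (l%:R / m.+1%:R) - y (l%:R / m.+1%:R)| <= e) ->
  (dM1 x y <= (3 * e)%:E)%E.
Proof.
move=> me xy; have e0 : 0 <= e by exact: le_trans me.
have yx : forall l : 'I_m.+2, `|y (l%:R / m.+1%:R) - x (l%:R / m.+1%:R)| <= e.
  by move=> l; rewrite distrC.
have level s : 0 <= s <= 1 -> `|diag_level x s - diag_level y s| <= e.
  move=> /andP[s0 s1]; have := xy ord0; have := xy ord_max.
  rewrite /= mul0r divff// !ler_norml /diag_level => /andP[h1 h2] /andP[h3 h4].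
  by apply/andP; split; nra.
have time s : 0 <= s <= 1 -> `|diag_time x s - diag_time y s| <= 2 * e.
  move=> s01; have := level s s01; have /andP[s0 _] := s01.
  rewrite !ler_norml => /andP[h1 h2].
  have h3 : diag_time x s <= diag_time y s + 2 * e.
    by apply: diag_time_levy => //; [lra|exact: grid_levy me xy].
  have h4 : diag_time y s <= diag_time x s + 2 * e.
    by apply: diag_time_levy => //; [lra|exact: grid_levy me yx].
  by apply/andP; split; lra.
apply: (@le_trans _ _ (maxe
    (ereal_sup [set (`|(diag_param x s).1 - (diag_param y s).1|)%:E | s in `[0, 1]])
    (ereal_sup [set (`|(diag_param x s).2 - (diag_param y s).2|)%:E | s in `[0, 1]]))).
  apply: ereal_inf_lbound; exists (diag_param x), (diag_param y).
  by split=> //; exact: diag_paramP.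
rewrite ge_max; apply/andP; split; apply: ge_ereal_sup => _ [s + <-];
  rewrite /= in_itv/= => s01; rewrite lee_fin.
  by apply: (le_trans (time s s01)); lra.
have := time s s01; have := level s s01; rewrite !ler_norml => /andP[? ?] /andP[? ?].
by apply/andP; split; lra.
Qed.

End path_parametrisation.

(** * Open sets seen through finitely many coordinates *)

Section grid_open.
Context {R : realType}.

Definition grid (m : nat) (l : 'I_m.+2) : R := l%:R / m.+1%:R.

Lemma grid01 m (l : 'I_m.+2) : 0 <= grid l <= 1.
Proof.
rewrite divr_ge0//= ler_pdivrMr ?ltr0n// mul1r ler_nat.
by rewrite -ltnS.
Qed.

(** Openness for the supremum distance on finitely many coordinates. *)
Definition box_open (I : finType) (O : set (I -> R)) := forall v, O v ->
  exists2 e, 0 < e & forall u, (forall i, `|u i - v i| < e) -> O u.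

(** Vectors that certify membership in [U] of every path with nearby grid values;
    the margin [h] exceeds the mesh, so that the certificate tolerates a further
    error of one mesh. *)
Definition grid_core (U : set (Dup R)) (m : nat) : set ('I_m.+2 -> R) :=
  [set v | exists2 h, m.+1%:R^-1 < h &
     forall x : Dup R, (forall l, `|x (grid l) - v l| < h) -> U x].

Lemma box_open_grid_core U m : box_open (@grid_core U m).
Proof.
move=> v [h]; have [c cE] : exists c : R, m.+1%:R^-1 = c by eexists.
rewrite /grid_core cE => ch vU; exists ((h - c) / 2).
  by rewrite divr_gt0// subr_gt0.
move=> u uv; exists ((h + c) / 2); first by lra.
move=> x xu; apply: vU => l; rewrite -(subrKA (u l)).
rewrite (le_lt_trans (ler_normD _ _))//.
by have := uv l; have := xu l; lra.
Qed.

Lemma grid_core_sub U m (v : 'I_m.+2 -> R) (x : Dup R) : grid_core U v ->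
  (forall l, `|x (grid l) - v l| <= m.+1%:R^-1) -> U x.
Proof. by move=> [h mh vU] xv; apply: vU => l; exact: le_lt_trans mh. Qed.

(** Grid-closeness at scale [2 / m.+1] bounds the distance by [6 / m.+1], which is
    eventually below the radius of a ball around the path inside [U]. *)
Lemma M1_open_grid_core U (x : Dup R) : M1_open U -> U x ->
  \forall m \near \oo, grid_core U (fun l : 'I_m.+2 => x (grid l)).
Proof.
move=> oU Ux; have [e e0 xU] := oU x Ux.
have e6 : 0 < (3 * 2)^-1 * e by rewrite mulr_gt0.
near=> m.
exists (2 / m.+1%:R); first by rewrite ltr_pMl ?invr_gt0// ltr1n.
move=> y yx; apply: xU.
apply: (@le_lt_trans _ _ (3 * (2 / m.+1%:R))%:E).
  apply: (@dM1_grid R m (2 / m.+1%:R)) => [|l]; first by rewrite ler_peMl// ler1n.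
  by rewrite distrC ltW// yx.
rewrite lte_fin mulrA -ltr_pdivlMl//.
by near: m; exact: near_infty_natSinv_lt (PosNum e6).
Unshelve. all: by end_near. Qed.

End grid_open.

Section rational_boxes.
Context {R : realType} {I : finType}.
Implicit Types (O : set (I -> R)) (v : I -> R) (b : {ffun I -> rat * rat}).

Definition rat_box b : set (I -> R) :=
  [set v | forall i, ratr (b i).1 < v i <= ratr (b i).2].

(** Extremal processes have an atom at zero at time zero, so convergence of the
    distribution functions is available only away from level zero. *)
Definition nonzero_box b := forall i, (b i).1 != 0 /\ (b i).2 != 0.

Lemma nonzero_rat_below (x e : R) : 0 < e ->
  exists2 r : rat, r != 0 & x - e < ratr r < x.
Proof.
move=> e0; have [x0|x0] := ltP 0 x.
  have /rat_in_itvoo[r] : Num.max 0 (x - e) < x by rewrite gt_max x0/= ltrBlDr ltrDl.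
  rewrite in_itv/= gt_max => /andP[/andP[r0 xr] rx].
  by exists r; rewrite ?xr// gt_eqF// -(ltr0q R).
have /rat_in_itvoo[r] : x - e < x by rewrite ltrBlDr ltrDl.
rewrite in_itv/= => /andP[xr rx]; exists r; rewrite ?xr//.
by rewrite lt_eqF// -(ltrq0 R) (lt_le_trans rx).
Qed.

Lemma nonzero_rat_around (x e : R) : 0 < e ->
  exists c : rat * rat, [/\ c.1 != 0, c.2 != 0, x - e < ratr c.1 < x &
    x < ratr c.2 < x + e].
Proof.
move=> e0; have [r r0 xr] := nonzero_rat_below x e0.
have [s s0 /andP[xs sx]] := nonzero_rat_below (- x) e0.
exists (r, - s); rewrite oppr_eq0; split=> //=.
by rewrite rmorphN/= ltrNr sx/= ltrNl opprD.
Qed.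

Lemma box_open_rat_box O v : box_open O -> O v ->
  exists b, [/\ nonzero_box b, rat_box b v & rat_box b `<=` O].
Proof.
move=> oO /oO[e e0 Oe].
have /choice[c cP] := fun i => nonzero_rat_around (v i) e0.
exists [ffun i => c i]; split.
- by move=> i; rewrite ffunE; have [] := cP i.
- move=> i; rewrite ffunE; have [_ _ /andP[_ ->] /andP[/ltW -> _]] := cP i; lra.
- move=> u ub; apply: Oe => i; move: (ub i); rewrite ffunE.
  have [_ _ /andP[? _] /andP[_ ?]] := cP i => /andP[? ?].
  by rewrite ltr_norml; apply/andP; split; lra.
Qed.

(** An enumeration of the rational boxes inside [O]; indices that code no such
    box contribute the empty set. *)
Definition box_seq O (n : nat) : set (I -> R) := [set v | exists b,
  [/\ choice.unpickle n = Some b, nonzero_box b, rat_box b `<=` O & rat_box b v]].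

Lemma box_seqE O : box_open O -> O = \bigcup_n box_seq O n.
Proof.
move=> oO; apply/seteqP; split=> [v /(box_open_rat_box oO)[b [b0 bv bO]]|v [n _ [b [_ _ bO bv]]]].
  by exists (choice.pickle b) => //; exists b; rewrite choice.pickleK.
exact: bO bv.
Qed.

Lemma box_seq_cases O n : box_seq O n = set0 \/
  exists b, [/\ nonzero_box b, rat_box b `<=` O & box_seq O n = rat_box b].
Proof.
have [->|/set0P[v [b [nb b0 bO bv]]]] := eqVneq (box_seq O n) set0; first by left.
right; exists b; split=> //; apply/seteqP; split=> [u [b' [nb' _ _]]|u bu].
  by move: nb'; rewrite nb => -[->].
by exists b.
Qed.

Lemma measurable_rat_box d (T : measurableType d) (X : T -> I -> R) b :
  (forall i, measurable_fun setT (X ^~ i)) -> measurable (X @^-1` rat_box b).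
Proof.
move=> mX; rewrite (_ : _ @^-1` _ = \bigcap_(i in [set: I])
    (X ^~ i) @^-1` `]ratr (b i).1, ratr (b i).2]%classic).
  apply: fin_bigcap_measurable => [|i _]; first exact: finite_finset.
  by rewrite -[X in measurable X]setTI; apply: mX.
apply/seteqP; split=> [w wb i _|w wb i]; first by rewrite /= in_itv/=; exact: wb.
by have := wb i Logic.I; rewrite /= in_itv.
Qed.

(** Boxes with rational ends are countably many, so an open set is a countable
    union of measurable boxes. *)
Lemma measurable_box_open d (T : measurableType d) (X : T -> I -> R) O :
  (forall i, measurable_fun setT (X ^~ i)) -> box_open O ->
  measurable (X @^-1` O).
Proof.
move=> mX oO; rewrite (box_seqE oO) preimage_bigcup; apply: bigcup_measurable => n _.
have [->|[b [_ _ ->]]] := box_seq_cases O n; first by rewrite preimage_set0.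
exact: measurable_rat_box.
Qed.

End rational_boxes.

Section prob.
Context d (T : measurableType d) (R : realType) (P : probability T R).
Implicit Types A B : set T.

(** Real-valued, so that differences carry no finiteness side conditions. *)
Definition prob A : R := fine (P A).

Lemma probK A : measurable A -> (prob A)%:E = P A.
Proof. by move=> mA; rewrite fineK// fin_num_measure. Qed.

Lemma prob_ge0 A : 0 <= prob A.
Proof. by rewrite fine_ge0. Qed.

Lemma prob_le A B : measurable A -> measurable B -> A `<=` B -> prob A <= prob B.
Proof.
by move=> mA mB AB; rewrite -lee_fin !probK//; apply: le_measure => //; rewrite inE.
Qed.

Lemma prob0 : prob set0 = 0.
Proof. by rewrite /prob measure0. Qed.

Lemma probT : prob setT = 1.
Proof. by rewrite /prob probability_setT. Qed.

Lemma probD A B : measurable A -> measurable B ->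
  prob (A `\` B) = prob A - prob (A `&` B).
Proof.
move=> mA mB; apply: EFin_inj; rewrite EFinB !probK//; last 2 first.
- exact: measurableI.
- exact: measurableD.
by rewrite measureD// -ge0_fin_numE// fin_num_measure.
Qed.

Lemma probU A B : measurable A -> measurable B ->
  prob (A `|` B) = prob A + prob B - prob (A `&` B).
Proof.
move=> mA mB; apply: EFin_inj; rewrite EFinB EFinD !probK//; last 2 first.
- exact: measurableI.
- exact: measurableU.
by rewrite measureUfinl// -ge0_fin_numE// fin_num_measure.
Qed.

Lemma prob_leU A B : measurable A -> measurable B ->
  prob (A `|` B) <= prob A + prob B.
Proof. by move=> mA mB; rewrite probU// lerBlDr lerDl prob_ge0. Qed.

Lemma prob_bigsetU (J : Type) (s : seq J) (F : J -> set T) :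
  (forall j, measurable (F j)) ->
  prob (\big[setU/set0]_(j <- s) F j) <= \sum_(j <- s) prob (F j).
Proof.
move=> mF; elim: s => [|j s IH]; first by rewrite !big_nil prob0.
rewrite !big_cons (le_trans (prob_leU _ _))// ?lerD2l//.
exact: bigsetU_measurable.
Qed.

Lemma prob_cvg_bigcup (F : nat -> set T) : (forall n, measurable (F n)) ->
  nondecreasing_seq F -> prob (F n) @[n --> \oo] --> prob (\bigcup_n F n).
Proof.
move=> mF ndF; have mU : measurable (\bigcup_n F n) by exact: bigcup_measurable.
apply: fine_cvg; rewrite probK//; exact: nondecreasing_cvg_mu.
Qed.

End prob.

(** * Convergence on orthants implies lower bounds on open sets *)

Section orthants.
Context {R : realType} {I : finType}.
Context d (T : measurableType d) (P : probability T R) (X : nat -> T -> I -> R).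
Context d' (T' : measurableType d') (P' : probability T' R) (Y : T' -> I -> R).
Hypothesis mX : forall n i, measurable_fun setT (X n ^~ i).
Hypothesis mY : forall i, measurable_fun setT (Y ^~ i).
Implicit Types (z : I -> R) (A B : set (I -> R)).

Definition prob_converges A :=
  [/\ forall n, measurable (X n @^-1` A), measurable (Y @^-1` A) &
      prob P (X n @^-1` A) @[n --> \oo] --> prob P' (Y @^-1` A)].

Lemma prob_converges0 : prob_converges set0.
Proof.
split=> [n||]; rewrite ?preimage_set0//.
under eq_fun do rewrite preimage_set0 prob0.
by rewrite prob0; exact: cvg_cst.
Qed.

Let preimage_setD (S : Type) (f : S -> I -> R) A B :
  f @^-1` (A `\` B) = f @^-1` A `\` f @^-1` B.
Proof. by []. Qed.

Lemma prob_convergesD A B : prob_converges A -> prob_converges B ->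
  prob_converges (A `&` B) -> prob_converges (A `\` B).
Proof.
move=> [mA mA' cA] [mB mB' cB] [_ _ cAB]; split=> [n||].
- by rewrite preimage_setD; apply: measurableD.
- by rewrite preimage_setD; apply: measurableD.
- rewrite preimage_setD probD// -preimage_setI.
  under eq_fun do rewrite preimage_setD probD// -preimage_setI.
  exact: (cvgB cA cAB).
Qed.

Lemma prob_convergesU A B : prob_converges A -> prob_converges B ->
  prob_converges (A `&` B) -> prob_converges (A `|` B).
Proof.
move=> [mA mA' cA] [mB mB' cB] [_ _ cAB]; split=> [n||].
- by rewrite preimage_setU; apply: measurableU.
- by rewrite preimage_setU; apply: measurableU.
- rewrite preimage_setU probU// -preimage_setI.
  under eq_fun do rewrite preimage_setU probU// -preimage_setI.
  exact: (cvgB (cvgD cA cB) cAB).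
Qed.

Definition orthant z : set (I -> R) := [set v | forall i, v i <= z i].

Lemma orthantI z1 z2 :
  orthant z1 `&` orthant z2 = orthant (fun i => Num.min (z1 i) (z2 i)).
Proof.
apply/seteqP; split=> [v [v1 v2] i|v v12].
  by rewrite le_min v1 v2.
by split=> i; have := v12 i; rewrite le_min => /andP[].
Qed.

Lemma min_neq0 (x y : R) : x != 0 -> y != 0 -> Num.min x y != 0.
Proof. by rewrite minEle; case: ifP. Qed.

(** Orthants minus finitely many orthants include the half-open boxes and are
    still stable under intersection; this is the removed part. *)
Definition coorthant (s : seq (I -> R)) : set (I -> R) :=
  [set v | foldr (fun z Q => ~ orthant z v /\ Q) True s].

Definition nonzero_seq (s : seq (I -> R)) :=
  foldr (fun z Q => (forall i, z i != 0) /\ Q) True s.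

Lemma coorthant_cat s1 s2 : coorthant (s1 ++ s2) = coorthant s1 `&` coorthant s2.
Proof.
suff h v : coorthant (s1 ++ s2) v <-> coorthant s1 v /\ coorthant s2 v.
  by apply/seteqP; split=> v /h.
by rewrite /coorthant; elim: s1 => [|z s1 IH] /=; [|rewrite /= in IH]; tauto.
Qed.

Lemma nonzero_cat s1 s2 : nonzero_seq s1 -> nonzero_seq s2 -> nonzero_seq (s1 ++ s2).
Proof. by elim: s1 => //= z s1 IH [z0 s10] s20; split=> //; exact: IH. Qed.

Hypothesis cvg_orthant : forall z, (forall i, z i != 0) ->
  prob P (X n @^-1` orthant z) @[n --> \oo] --> prob P' (Y @^-1` orthant z).

Lemma measurable_orthant e (S : measurableType e) (V : S -> I -> R) z :
  (forall i, measurable_fun setT (V ^~ i)) -> measurable (V @^-1` orthant z).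
Proof.
move=> mV; rewrite (_ : _ @^-1` _ = \bigcap_(i in [set: I])
    (V ^~ i) @^-1` `]-oo, z i]%classic).
  apply: fin_bigcap_measurable => [|i _]; first exact: finite_finset.
  by rewrite -[X in measurable X]setTI; apply: mV.
apply/seteqP; split=> [w wb i _|w wb i]; first by rewrite /= in_itv/=; exact: wb.
by have := wb i Logic.I; rewrite /= in_itv.
Qed.

(** Removing one more orthant is a set difference with an intersection of the same
    form, hence an induction on the number of removed orthants. *)
Lemma prob_converges_coorthant z s : (forall i, z i != 0) -> nonzero_seq s ->
  prob_converges (orthant z `&` coorthant s).
Proof.
elim: s z => [|z' s IH] z z0 => [_|[z'0 s0]].
  rewrite (_ : _ `&` _ = orthant z); first last.
    by apply/seteqP; split=> v // [].
  by split=> [n||]; [exact: measurable_orthant|exact: measurable_orthant|exact: cvg_orthant].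
rewrite (_ : _ `&` _ = (orthant z `&` coorthant s) `\`
   (orthant (fun i => Num.min (z i) (z' i)) `&` coorthant s)); last first.
  rewrite -orthantI; apply/seteqP; split=> v.
    by move=> [vz [vz' vs]]; split=> // -[[]].
  by move=> [[vz vs] h]; split=> //; split=> // vz'; exact: h.
have c' : prob_converges (orthant (fun i => Num.min (z i) (z' i)) `&` coorthant s).
  by apply: IH => // i; exact: min_neq0.
apply: prob_convergesD => //; first exact: IH.
suff -> : orthant z `&` coorthant s `&` (orthant (fun i => Num.min (z i) (z' i)) `&`
  coorthant s) = orthant (fun i => Num.min (z i) (z' i)) `&` coorthant s by [].
by rewrite -orthantI; apply/seteqP; split=> v; [case|case=> -[? ?] ?].
Qed.

Definition cell (c : (I -> R) * seq (I -> R)) := orthant c.1 `&` coorthant c.2.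

Definition nonzero_cell (c : (I -> R) * seq (I -> R)) :=
  (forall i, c.1 i != 0) /\ nonzero_seq c.2.

Definition cellI (c1 c2 : (I -> R) * seq (I -> R)) :=
  (fun i => Num.min (c1.1 i) (c2.1 i), c1.2 ++ c2.2).

Lemma cellIE c1 c2 : cell (cellI c1 c2) = cell c1 `&` cell c2.
Proof. by rewrite /cell coorthant_cat -orthantI setIACA. Qed.

Lemma nonzero_cellI c1 c2 : nonzero_cell c1 -> nonzero_cell c2 ->
  nonzero_cell (cellI c1 c2).
Proof.
move=> [z1 s1] [z2 s2]; split=> [i|]; [exact: min_neq0|exact: nonzero_cat].
Qed.

Definition cells (l : seq ((I -> R) * seq (I -> R))) :=
  \big[setU/set0]_(c <- l) cell c.

(** Inclusion-exclusion, one cell at a time: the intersection of a cell with a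
    union of [k] cells is again a union of [k] cells. *)
Lemma prob_converges_cells l : foldr (fun c Q => nonzero_cell c /\ Q) True l ->
  prob_converges (cells l).
Proof.
have [k] := ubnP (size l); elim: k l => // k IH [|c l] lk.
  by rewrite /cells big_nil => _; exact: prob_converges0.
move=> /= [c0 l0]; rewrite /cells big_cons; apply: prob_convergesU.
- by apply: prob_converges_coorthant; case: c0.
- exact: IH.
- rewrite -/(cells _) (_ : _ `&` _ = cells (map (cellI c) l)); last first.
    rewrite /cells; elim: l {lk l0} => [|c' l IH']; first by rewrite !big_nil setI0.
    by rewrite /= !big_cons cellIE -IH' setIUr.
  apply: IH; first by rewrite size_map.
  by elim: l l0 {lk} => //= c' l IH' [c'0 l0]; split; [exact: nonzero_cellI|exact: IH'].
Qed.

(** A half-open box is the orthant at its upper corner minus the orthants obtained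
    by lowering one coordinate of that corner to the lower end. *)
Lemma rat_box_cell (b : {ffun I -> rat * rat}) : nonzero_box b ->
  exists2 c, nonzero_cell c & rat_box b = cell c :> set (I -> R).
Proof.
move=> b0; pose up : I -> R := fun i => ratr (b i).2.
pose low (i : I) : I -> R := fun j => if j == i then ratr (b i).1 else ratr (b j).2.
have r0 (r : rat) : r != 0 -> (ratr r : R) != 0 by rewrite fmorph_eq0.
exists (up, map low (enum I)).
  split=> [i|/=]; first by apply: r0; case: (b0 i).
  elim: (enum I) => //= i s IH; split=> // j; rewrite /low.
  by case: ifP => _; apply: r0; [case: (b0 i)|case: (b0 j)].
have lowP v : v \in orthant up -> forall s, coorthant (map low s) v <->
    forall i, i \in s -> ratr (b i).1 < v i.
  rewrite inE => vup; elim=> [|i s IH]; first by split.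
  split.
    move=> [vlow /IH h] j; rewrite inE => /predU1P[->{j}|/h//].
    rewrite ltNge; apply/negP => vi; apply: vlow => j; rewrite /low.
    by have [->|_] := eqVneq j i; [|exact: vup].
  move=> h; split; last by apply/IH => j js; apply: h; rewrite inE js orbT.
  move=> /(_ i); rewrite /low eqxx; apply/negP; rewrite -ltNge; apply: h.
  by rewrite inE eqxx.
apply/seteqP; split=> v.
  move=> vb; have vup : orthant up v by move=> i; case/andP: (vb i).
  split=> //; apply/lowP; first by rewrite inE.
  by move=> i _; case/andP: (vb i).
by move=> [vup]; rewrite lowP ?inE// => h i; rewrite h ?mem_enum//=.
Qed.

Lemma prob_converges_boxes O N :
  prob_converges (\big[setU/set0]_(n < N) box_seq O n).
Proof.
have [l l0 ->] : exists2 l, foldr (fun c Q => nonzero_cell c /\ Q) True l &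
    \big[setU/set0]_(n < N) box_seq O n = cells l; last exact: prob_converges_cells.
elim: N => [|N [l l0 E]].
  by exists [::]; rewrite // /cells big_ord0 big_nil.
have [E0|[b [b0 _ bE]]] := box_seq_cases O N.
  by exists l; rewrite // big_ord_recr/= E0 setU0.
have [c c0 cE] := rat_box_cell b0.
by exists (c :: l); rewrite // big_ord_recr/= E bE cE /cells big_cons setUC.
Qed.

(** Orthants form a pi-system and boxes with nonzero ends are obtained from
    them by finitely many set operations, so convergence on orthants passes to
    finite unions of boxes, which exhaust any open set from inside. *)
Lemma prob_box_open_liminf O (e : R) : box_open O -> 0 < e ->
  \forall n \near \oo, prob P' (Y @^-1` O) - e < prob P (X n @^-1` O).
Proof.
move=> oO e0.
pose U N := \big[setU/set0]_(n < N) box_seq O n.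
have UE : O = \bigcup_N U N.
  rewrite {1}(box_seqE oO); apply/seteqP; split=> [v [n _ vn]|v [N _]].
    by exists n.+1 => //; rewrite /U big_ord_recr/=; right.
  by rewrite /U -bigcup_mkord => -[n _ vn]; exists n.
have mYU N : measurable (Y @^-1` U N) by have [] := prob_converges_boxes O N.
have ndU : nondecreasing_seq (fun N => Y @^-1` U N).
  move=> N N' NN'; apply/subsetPset => w; rewrite /preimage/= /U.
  rewrite -!bigcup_mkord => -[n /= nN wn]; exists n => //=; exact: leq_trans NN'.
have /cvgrPdist_lt/(_ (e / 2)) := prob_cvg_bigcup (P := P') mYU ndU.
rewrite divr_gt0// -preimage_bigcup -UE => /(_ isT) [N _ /(_ N (leqnn N))/=].
rewrite ltr_norml => /andP[_ hN].
have [mXU _ /cvgrPdist_lt/(_ (e / 2))] := prob_converges_boxes O N.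
rewrite divr_gt0// => /(_ isT); apply: filterS => n; rewrite ltr_norml => /andP[_ hn].
have : prob P (X n @^-1` U N) <= prob P (X n @^-1` O).
  apply: prob_le; [exact: mXU|exact: measurable_box_open|].
  by rewrite [X in _ `<=` _ @^-1` X]UE; apply: preimage_subset; exact: bigcup_sup.
by rewrite -/(U N) in hn *; lra.
Qed.

End orthants.

(** * From open sets to means of bounded continuous functions *)

Section bounded_mean.
Context d (T : measurableType d) (R : realType) (P : probability T R).
Implicit Types (f g : T -> R).

Definition mean f : R := fine 'E_P[f].

Lemma bounded_integrable f (K : R) : measurable_fun setT f ->
  (forall w, `|f w| <= K) -> P.-integrable setT (EFin \o f).
Proof.
move=> mf fK; apply: measurable_bounded_integrable => //.
  by rewrite -ge0_fin_numE// fin_num_measure.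
exists K; split; first by rewrite num_real.
by move=> M KM w _; exact: (le_trans (fK w) (ltW KM)).
Qed.

Lemma meanK f (K : R) : measurable_fun setT f -> (forall w, `|f w| <= K) ->
  (mean f)%:E = 'E_P[f]%E.
Proof.
move=> mf fK; rewrite /mean fineK// expectation_fin_num//.
by apply/Lfun1_integrable; exact: bounded_integrable fK.
Qed.

Lemma mean_le f g (K : R) : measurable_fun setT f -> measurable_fun setT g ->
  (forall w, 0 <= f w) -> (forall w, f w <= g w) -> (forall w, g w <= K) -> 
  mean f <= mean g.
Proof.
move=> mf mg f0 fg gK.
have f_bd w : `|f w| <= K by rewrite ger0_norm// (le_trans (fg w)).
have g_bd w : `|g w| <= K by rewrite ger0_norm// (le_trans (f0 w)).
rewrite -lee_fin (meanK mf f_bd) (meanK mg g_bd); apply: expectation_le => //.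
- by move=> w; rewrite (le_trans (f0 w)).
- exact: aeW.
Qed.

Lemma meanD f g (K K' : R) : measurable_fun setT f -> measurable_fun setT g ->
  (forall w, `|f w| <= K) -> (forall w, `|g w| <= K') ->
  mean (fun w => f w + g w) = mean f + mean g.
Proof.
move=> mf mg fK gK; apply: EFin_inj.
have iL (h : T -> R) (L : R) : measurable_fun setT h -> (forall w, `|h w| <= L) -> h \in Lfun P 1.
  by move=> mh hL; apply/Lfun1_integrable; exact: bounded_integrable hL.
rewrite EFinD (meanK mf fK) (meanK mg gK) -(expectationD (iL f K mf fK) (iL g K' mg gK)).
rewrite (@meanK _ (K + K'))//; first exact: measurable_funD.
by move=> w; rewrite (le_trans (ler_normD _ _))// lerD.
Qed.

Lemma meanN f (K : R) : measurable_fun setT f -> (forall w, `|f w| <= K) ->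
  mean (fun w => - f w) = - mean f.
Proof.
move=> mf fK; apply/eqP; rewrite -addr_eq0 -(@meanD _ _ K K)//.
- by under eq_fun do rewrite addNr; rewrite /mean expectation_cst.
- exact: measurableT_comp.
- by move=> w; rewrite normrN.
Qed.

Lemma mean_cst (c : R) : mean (cst c) = c.
Proof. by rewrite /mean expectation_cst. Qed.

(** A Riemann sum of the layer-cake formula with step [h]. *)
Definition layers (h : R) (N : nat) f (w : T) : R :=
  \sum_(i < N) h * \1_[set w | i.+1%:R * h < f w] w.

Lemma measurable_superlevel f (c : R) : measurable_fun setT f ->
  measurable [set w | c < f w].
Proof.
move=> mf; rewrite (_ : [set w | _] = setT `&` f @^-1` `]c, +oo[%classic).
  exact: mf.
by apply/seteqP; split=> w; rewrite /= in_itv/= andbT// => -[].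
Qed.

Lemma measurable_layers h N f : measurable_fun setT f -> measurable_fun setT (layers h N f).
Proof.
move=> mf; apply: measurable_sum => i; apply: measurable_funM => //.
by apply: measurable_indic; exact: measurable_superlevel.
Qed.

Lemma layers_ge0 h N f w : 0 <= h -> 0 <= layers h N f w.
Proof. by move=> h0; apply: sumr_ge0 => i _; rewrite mulr_ge0// indicE. Qed.

(** The sum is [h] times the number of the first [N] multiples of [h] lying below
    [f w]; the last alternative is the case in which all [N] of them do. *)
Lemma layersP h N f w : 0 <= h -> 0 <= f w ->
  [/\ layers h N f w <= f w, layers h N f w <= N%:R * h &
      f w <= h + layers h N f w \/ N%:R * h <= layers h N f w].
Proof.
move=> h0 f0; elim: N => [|N [S1 S2 S3]]; rewrite /layers.
  by rewrite big_ord0 mul0r; split=> //; right.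
rewrite big_ord_recr/= -/(layers h N f w) indicE.
have NE : N.+1%:R * h = N%:R * h + h by rewrite -natr1 mulrDl mul1r.
have [hf|hf] := ltP (N.+1%:R * h) (f w); [rewrite mem_set//|rewrite memNset//=];
  try by rewrite ltNge hf.
  rewrite mulr1 NE in hf *; split; [lra|lra|].
  by case: S3 => ?; [left|right]; lra.
rewrite mulr0 addr0 NE in hf *; split; [lra|lra|].
by left; case: S3 => ?; lra.
Qed.

Lemma mean_layers h N f : measurable_fun setT f -> 0 <= h ->
  mean (layers h N f) = \sum_(i < N) h * prob P [set w | i.+1%:R * h < f w].
Proof.
move=> mf h0; have mA i := measurable_superlevel (i.+1%:R * h) mf.
rewrite /mean unlock; under eq_integral do rewrite /layers -sumEFin.
rewrite ge0_integral_sum//; last 2 first.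
- move=> i; apply/measurable_EFinP; exact: measurable_funM.
- by move=> i w _; rewrite lee_fin mulr_ge0// indicE.
under eq_bigr => i _.
  under eq_integral do rewrite EFinM.
  rewrite ge0_integralZl_EFin//; last by apply/measurable_EFinP; exact: measurable_indic.
  rewrite (_ : integral _ _ _ = (prob P [set w | i.+1%:R * h < f w])%:E); last first.
    by rewrite probK// integral_indic// setIT.
  rewrite -EFinM; over.
by rewrite sumEFin.
Qed.

End bounded_mean.

Section open_portmanteau.
Context {R : realType} (E : topologicalType).
Context d (T : measurableType d) (P : probability T R) (X : nat -> T -> E).
Context d' (T' : measurableType d') (P' : probability T' R) (Y : T' -> E).

Lemma measurable_continuous_comp e (S : measurableType e) (V : S -> E) (f : E -> R) :
  random_element V -> continuous f -> measurable_fun setT (f \o V).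
Proof.
move=> rV cf; move=> _; apply: (measurability _ (RGenOInfty.measurableE R)) => // _ /= [_ [x ->] <-].
rewrite setTI; apply: (rV (f @^-1` `]x, +oo[%classic)); apply: sub_sigma_algebra.
by move/continuousP: cf; apply; exact: interval_open.
Qed.

Hypotheses (rX : forall n, random_element (X n)) (rY : random_element Y).
Hypothesis open_liminf : forall U, open U -> forall e : R, 0 < e ->
  \forall n \near \oo, prob P' (Y @^-1` U) - e < prob P (X n @^-1` U).

Lemma mean_liminf (g : E -> R) (K e : R) : continuous g ->
  (forall x, 0 <= g x <= K) -> 0 < K -> 0 < e ->
  \forall n \near \oo, mean P' (g \o Y) - e < mean P (g \o X n).
Proof.
move=> cg gK K0 e0.
(* the step of the layers accounts for one half of the error, the finitely many
   layer probabilities for the other *)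
have [N hN] : exists N : nat, K / N.+1%:R < e / 2.
  have e2 : 0 < e / 2 / K by rewrite !divr_gt0.
  have [N _ /(_ N (leqnn N))/=] := near_infty_natSinv_lt (PosNum e2).
  by rewrite /= => hN; exists N; rewrite mulrC -ltr_pdivlMr.
pose h := K / N.+1%:R; have h0 : 0 <= h by rewrite divr_ge0// ltW.
have NhK : N.+1%:R * h = K by rewrite /h mulrC divfK.
have mgY : measurable_fun setT (g \o Y) by exact: measurable_continuous_comp.
have mgX n : measurable_fun setT (g \o X n) by exact: measurable_continuous_comp.
have upper : mean P' (g \o Y) <= h + \sum_(i < N.+1) h *
    prob P' [set w | i.+1%:R * h < (g \o Y) w].
  rewrite -mean_layers// -{1}(mean_cst P' h) -(@meanD _ _ _ _ _ _ h K)//.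
  - apply: (@mean_le _ _ _ _ _ _ (h + K)) => //.
    + by apply: measurable_funD => //; exact: measurable_layers.
    + by move=> w /=; have /andP[] := gK (Y w).
    + move=> w; have /andP[g0 gK'] := gK (Y w).
      have [_ S2] := layersP (f := g \o Y) (w := w) N.+1 h0 g0.
      by case=> // ?; rewrite /=; lra.
    + move=> w; have /andP[g0 gK'] := gK (Y w).
      have [S1 _ _] := layersP (f := g \o Y) (w := w) N.+1 h0 g0.
      by rewrite /= in S1 *; lra.
  - exact: measurable_layers.
  - by move=> w; rewrite ger0_norm.
  - move=> w; have /andP[g0 gK'] := gK (Y w).
    have [S1 _ _] := layersP (f := g \o Y) (w := w) N.+1 h0 g0.
    by rewrite ger0_norm ?layers_ge0// (le_trans S1).
have lower n : \sum_(i < N.+1) h * prob P [set w | i.+1%:R * h < (g \o X n) w]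
    <= mean P (g \o X n).
  rewrite -mean_layers//; apply: (@mean_le _ _ _ _ _ _ K) => //.
  - exact: measurable_layers.
  - by move=> w; exact: layers_ge0.
  - move=> w; have /andP[g0 gK'] := gK (X n w).
    by have [] := layersP (f := g \o X n) (w := w) N.+1 h0 g0.
  - by move=> w; have /andP[] := gK (X n w).
have e2K : 0 < e / (2 * K) by rewrite divr_gt0// mulr_gt0.
have : \forall n \near \oo, forall i : 'I_N.+1,
    prob P' [set w | i.+1%:R * h < (g \o Y) w] - e / (2 * K) <
    prob P [set w | i.+1%:R * h < (g \o X n) w].
  apply: filter_forall => i.
  have oU : open [set x | i.+1%:R * h < g x].
    by move/continuousP: (cg) => /(_ _ (@open_gt R (i.+1%:R * h))).
  exact: open_liminf oU _ e2K.
apply: filterS => n hn; apply: lt_le_trans (lower n).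
have SE : \sum_(i < N.+1) h * (e / (2 * K)) = e / 2.
  rewrite sumr_const card_ord -[LHS]mulr_natl [LHS]mulrA NhK; field.
  by rewrite gt_eqF.
have : \sum_(i < N.+1) h * prob P' [set w | i.+1%:R * h < (g \o Y) w] <=
    \sum_(i < N.+1) h * prob P [set w | i.+1%:R * h < (g \o X n) w] + e / 2.
  rewrite -SE -big_split/= ler_sum// => i _.
  by rewrite -mulrDr ler_wpM2l// -lerBlDr ltW.
by rewrite -/h in hN; lra.
Qed.

(** Layer-cake sums turn lower bounds for open sets into lower bounds for means
    of nonnegative functions; both [K + f] and [K - f] are nonnegative. *)
Lemma cvg_expectation_open (f : E -> R) (K : R) : continuous f ->
  (forall x, `|f x| <= K) -> ('E_P[f \o X n] @[n --> \oo] --> 'E_P'[f \o Y])%E.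
Proof.
move=> cf fK'; pose K1 := `|K| + 1; have K1_gt0 : 0 < K1 by rewrite ltr_wpDl.
have fK x : `|f x| <= K1.
  by rewrite (le_trans (fK' x))// (le_trans (ler_norm _))// lerDl.
have mfY : measurable_fun setT (f \o Y) by exact: measurable_continuous_comp.
have mfX n : measurable_fun setT (f \o X n) by exact: measurable_continuous_comp.
have shift e (S : measurableType e) (Q : probability S R) (V : S -> E) :
    measurable_fun setT (f \o V) -> mean Q ((fun x => K1 + f x) \o V) = K1 + mean Q (f \o V)
    /\ mean Q ((fun x => K1 - f x) \o V) = K1 - mean Q (f \o V).
  move=> mfV; split.
    rewrite (@meanD _ _ _ Q (cst K1) (f \o V) K1 K1) ?mean_cst//.
      by move=> w; rewrite ger0_norm// ltW.
    by move=> w; exact: fK.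
  rewrite (@meanD _ _ _ Q (cst K1) (fun w => - f (V w)) K1 K1) ?mean_cst//.
  - by rewrite (@meanN _ _ _ Q (f \o V) K1)// => w; exact: fK.
  - exact: measurableT_comp mfV.
  - by move=> w; rewrite ger0_norm// ltW.
  - by move=> w; rewrite normrN; exact: fK.
rewrite -(meanK P' mfY (fun w => fK _)).
under eq_fun do rewrite -(meanK P (mfX _) (fun w => fK _)).
apply: cvg_EFin; first by apply: nearW => n; rewrite /= fin_numE.
rewrite /comp/=; apply/cvgrPdist_lt => e e0.
have bd x : 0 <= K1 + f x <= 2 * K1.
  by have := fK x; rewrite ler_norml => /andP[? ?]; apply/andP; split; lra.
have bd' x : 0 <= K1 - f x <= 2 * K1.
  by have := fK x; rewrite ler_norml => /andP[? ?]; apply/andP; split; lra.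
have K2 : 0 < 2 * K1 by rewrite mulr_gt0.
have c1 : continuous (fun x => K1 + f x).
  by move=> x; apply: cvgD; [exact: cvg_cst|exact: cf].
have c2 : continuous (fun x => K1 - f x).
  by move=> x; apply: cvgB; [exact: cvg_cst|exact: cf].
near=> n.
have h1 : mean P' ((fun x => K1 + f x) \o Y) - e < mean P ((fun x => K1 + f x) \o X n).
  by near: n; exact: mean_liminf c1 bd K2 e0.
have h2 : mean P' ((fun x => K1 - f x) \o Y) - e < mean P ((fun x => K1 - f x) \o X n).
  by near: n; exact: mean_liminf c2 bd' K2 e0.
have [e1 e2] := shift _ _ P' Y mfY; have [e3 e4] := shift _ _ P (X n) (mfX n).
rewrite e1 e3 in h1; rewrite e2 e4 in h2; rewrite ltr_norml; apply/andP; split.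
- by rewrite /= in h1 h2 *; lra.
- by rewrite /= in h1 h2 *; lra.
Unshelve. all: by end_near. Qed.

End open_portmanteau.

(** * Random elements of the path space *)

Section path_valued.
Context {R : realType}.

Lemma random_element_generated d (T : measurableType d) (E : topologicalType)
    (X : T -> E) : (forall U, open U -> measurable (X @^-1` U)) -> random_element X.
Proof.
move=> oX; rewrite /random_element.
have sX : sigma_algebra setT [set A | measurable (X @^-1` A)].
  split=> /=; first by rewrite preimage_set0.
    by move=> A mA; rewrite setTD; exact: measurableC.
  by move=> F mF; rewrite preimage_bigcup; exact: bigcup_measurable.
by move=> A; apply: (smallest_sub sX) => U /oX.
Qed.

Definition grid_values (m : nat) (x : Dup R) : 'I_m.+2 -> R := fun l => x (grid l).

Lemma measurable_grid_values d (T : measurableType d) (X : T -> Dup R) m l :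
  (forall t, 0 <= t <= 1 -> measurable_fun setT (fun w => X w t)) ->
  measurable_fun setT (fun w => @grid_values m (X w) l).
Proof. by move=> mX; apply: mX; exact: grid01. Qed.

(** An open set of paths is the countable union over the mesh of the sets of
    paths whose grid values lie in the core, which are finite-dimensional. *)
Lemma measurable_M1_open d (T : measurableType d) (X : T -> Dup R) U :
  (forall t, 0 <= t <= 1 -> measurable_fun setT (fun w => X w t)) ->
  open U -> measurable (X @^-1` U).
Proof.
move=> mX oU.
rewrite (_ : _ @^-1` _ = \bigcup_m (fun w => @grid_values m (X w)) @^-1` @grid_core R U m); last first.
  apply/seteqP; split=> [w Uw|w [m _ /= Um]].
    have [m _ /(_ m (leqnn m)) Um] := M1_open_grid_core oU Uw.
    by exists m.
  by apply: (grid_core_sub Um) => l; rewrite subrr normr0 invr_ge0.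
apply: bigcup_measurable => m _; apply: measurable_box_open.
  by move=> l; exact: measurable_grid_values.
exact: box_open_grid_core.
Qed.

Lemma random_element_Dup d (T : measurableType d) (X : T -> Dup R) :
  (forall t, 0 <= t <= 1 -> measurable_fun setT (fun w => X w t)) ->
  random_element X.
Proof.
by move=> mX; apply: random_element_generated => U; exact: measurable_M1_open.
Qed.

Context d (T : measurableType d) (P : probability T R) (X : nat -> T -> Dup R).
Context d' (T' : measurableType d') (P' : probability T' R) (Y : T' -> Dup R).
Context (V : forall m : nat, nat -> T -> 'I_m.+2 -> R).
Hypothesis mX : forall n t, 0 <= t <= 1 -> measurable_fun setT (fun w => X n w t).
Hypothesis mY : forall t, 0 <= t <= 1 -> measurable_fun setT (fun w => Y w t).
Hypothesis mV : forall m n l, measurable_fun setT (fun w => @V m n w l).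
Hypothesis V_liminf : forall m (O : set ('I_m.+2 -> R)) (e : R), box_open O -> 0 < e ->
  \forall n \near \oo, prob P' ((fun w => @grid_values m (Y w)) @^-1` O) - e <
    prob P (@V m n @^-1` O).
Hypothesis XV : forall m (h : R), 0 < h ->
  prob P [set w | exists l, h < `|X n w (grid l) - @V m n w l|] @[n --> \oo] --> (0 : R).

(** The grid values of a path of the open set lie in the cores from some mesh on,
    so a single grid already captures almost all of the probability; the slack
    in the core absorbs the approximation error. *)
Lemma M1_open_liminf U (e : R) : open U -> 0 < e ->
  \forall n \near \oo, prob P' (Y @^-1` U) - e < prob P (X n @^-1` U).
Proof.
move=> oU e0.
pose A m : set T' := (fun w => @grid_values m (Y w)) @^-1` @grid_core R U m.
pose F m : set T' := \bigcap_(k in [set k | (m <= k)%N]) A k.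
have mA m : measurable (A m).
  apply: measurable_box_open; last exact: box_open_grid_core.
  by move=> l; exact: measurable_grid_values.
have mF m : measurable (F m) by apply: bigcap_measurable => // ; exists m => /=.
have ndF : nondecreasing_seq F.
  move=> m k mk; apply/subsetPset => w Fw i /= ki; apply: Fw => /=; exact: leq_trans ki.
have FU : Y @^-1` U `<=` \bigcup_m F m.
  move=> w Uw; have [m _ hm] := M1_open_grid_core oU Uw.
  by exists m => // k /= mk; exact: hm.
have mU : measurable (\bigcup_m F m) by exact: bigcup_measurable.
have /cvgrPdist_lt/(_ (e / 3)) := prob_cvg_bigcup (P := P') mF ndF.
rewrite divr_gt0// => /(_ isT) [m _ /(_ m (leqnn m))/=].
rewrite ltr_norml => /andP[_ hm].
have leU : prob P' (Y @^-1` U) <= prob P' (\bigcup_m F m).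
  by apply: prob_le => //; exact: measurable_M1_open.
have leF : prob P' (F m) <= prob P' (A m) by apply: prob_le => // w Fw; exact: (Fw m (leqnn m)).
have m0 : 0 < m.+1%:R^-1 :> R by rewrite invr_gt0.
have e3 : 0 < e / 3 by rewrite divr_gt0.
near=> n.
have h1 : prob P' (A m) - e / 3 < prob P (@V m n @^-1` @grid_core R U m).
  by near: n; apply: V_liminf => //; exact: box_open_grid_core.
have h2 : prob P [set w | exists l, m.+1%:R^-1 < `|X n w (grid l) - @V m n w l|] < e / 3.
  rewrite -[ltLHS](ger0_norm (prob_ge0 P _)) -normrN -[- _]sub0r.
  near: n; have := @XV m _ m0 => /cvgrPdist_lt; exact.
pose B := [set w | exists l, m.+1%:R^-1 < `|X n w (grid l) - @V m n w l|].
have mVU : measurable (@V m n @^-1` @grid_core R U m).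
  by apply: measurable_box_open => //; exact: box_open_grid_core.
have mXU : measurable (X n @^-1` U) by exact: (measurable_M1_open (mX n)).
have mB : measurable B.
  rewrite (_ : B = \bigcup_(l in [set: 'I_m.+2]) [set w | m.+1%:R^-1 < `|X n w (grid l) - @V m n w l|]).
    apply: fin_bigcup_measurable => [|l _]; first exact: finite_finset.
    apply: measurable_superlevel; apply: measurableT_comp => //.
    by apply: measurable_funB => //; apply: mX; exact: grid01.
  by apply/seteqP; split=> w; [move=> [l hl]; exists l|move=> [l _ hl]; exists l].
have h3 : prob P (@V m n @^-1` @grid_core R U m) <= prob P (X n @^-1` U `|` B).
  apply: prob_le => //; first exact: measurableU.
  move=> w Vw; have [Bw|nBw] := pselect (B w); [by right|left].
  apply: (grid_core_sub Vw) => l; rewrite leNgt; apply/negP => hl.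
  by apply: nBw; exists l.
have h4 := prob_leU P mXU mB; rewrite -/B in h2.
have -> : e = e / 3 + e / 3 + e / 3 by field.
lra.
Unshelve. all: by end_near. Qed.

End path_valued.

(** * One large innovation per window *)

Section one_big_jump.
Context {R : realType}.

Definition running_max (x0 : R) (F : nat -> R) (N : nat) : R :=
  \big[Num.max/x0]_(1 <= i < N.+1) F i.

Lemma running_max_leP x0 F N y : running_max x0 F N <= y <->
  x0 <= y /\ forall i, (0 < i <= N)%N -> F i <= y.
Proof.
rewrite /running_max.
have h (s : seq nat) : \big[Num.max/x0]_(i <- s) F i <= y <->
    x0 <= y /\ forall i, i \in s -> F i <= y.
  elim: s => [|j s IH]; first by rewrite big_nil; split=> // -[].
  rewrite big_cons ge_max; split.
    move=> /andP[hj /IH[h0 hs]]; split=> // i; rewrite inE => /predU1P[->//|].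
    exact: hs.
  move=> [h0 hs]; rewrite hs ?mem_head//=; apply/IH; split=> // i si.
  by apply: hs; rewrite inE si orbT.
rewrite h; split=> -[h0 hs]; split=> // i.
  by move=> iN; apply: hs; rewrite mem_index_iota ltnS.
by rewrite mem_index_iota ltnS; exact: hs.
Qed.

Lemma running_max_ge x0 F N i : (0 < i <= N)%N -> F i <= running_max x0 F N.
Proof. by have /running_max_leP[_ ] := lexx (running_max x0 F N); apply. Qed.

Lemma running_max_ge0 x0 F N : x0 <= running_max x0 F N.
Proof. by have /running_max_leP[] := lexx (running_max x0 F N). Qed.

Context (q : nat) (c : 'I_q.+1 -> R) (z : int -> R).

Definition weight : R := \sum_(k < q.+1) `|c k|.

Definition moving_sum (t : int) : R := \sum_(k < q.+1) c k * z (t - (k : nat)%:Z).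

Definition pos_coef : R := \big[Num.max/0]_(j < q.+1) Num.max (c j) 0.
Definition neg_coef : R := \big[Num.max/0]_(j < q.+1) Num.max (- c j) 0.

Lemma pos_coef_ge0 : 0 <= pos_coef. Proof. exact: bigmax_ge_id. Qed.
Lemma neg_coef_ge0 : 0 <= neg_coef. Proof. exact: bigmax_ge_id. Qed.

Lemma pos_coef_ge k : c k <= pos_coef.
Proof. by apply: (bigmax_sup k) => //; rewrite le_max lexx. Qed.

Lemma neg_coef_ge k : - c k <= neg_coef.
Proof. by apply: (bigmax_sup k) => //; rewrite le_max lexx. Qed.

Lemma weight_ge0 : 0 <= weight. Proof. by apply: sumr_ge0. Qed.

Variable kappa : R.
Hypothesis kappa_ge0 : 0 <= kappa.

Lemma moving_sum_near_term t (k0 : 'I_q.+1) :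
  (forall k, k != k0 -> `|z (t - (k : nat)%:Z)| <= kappa) ->
  `|moving_sum t - c k0 * z (t - (k0 : nat)%:Z)| <= weight * kappa.
Proof.
move=> h; rewrite /moving_sum (bigD1 k0)//= addrAC subrr add0r.
rewrite (le_trans (ler_norm_sum _ _ _))// /weight mulr_suml.
rewrite [leRHS](bigD1 k0)//= ler_wpDl ?mulr_ge0// ler_sum// => k kk0.
by rewrite normrM ler_wpM2l// h.
Qed.

Lemma moving_sum_small t : (forall k : 'I_q.+1, `|z (t - (k : nat)%:Z)| <= kappa) ->
  `|moving_sum t| <= weight * kappa.
Proof.
move=> h; rewrite (le_trans (ler_norm_sum _ _ _))// /weight mulr_suml.
by rewrite ler_sum// => k _; rewrite normrM ler_wpM2l// h.
Qed.

Variables (n N : nat).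
Hypothesis Nn : (N <= n)%N.
Hypothesis separated : forall i j : int, 1 - q%:Z <= i -> i < j -> j <= n%:Z ->
  j - i <= q%:Z -> kappa < `|z i| -> `|z j| <= kappa.
Hypothesis edge_start : forall i : int, 1 - q%:Z <= i -> i <= 1 -> `|z i| <= kappa.
Hypothesis edge_end : forall i : int, N%:Z - q%:Z < i -> i <= N%:Z -> `|z i| <= kappa.

Let G := running_max (moving_sum 1) (fun i => moving_sum i%:Z) N.
Let A := running_max 0 (fun i => z i%:Z) N.
Let B := running_max 0 (fun i => - z i%:Z) N.
Let V := Num.max (pos_coef * A) (neg_coef * B).

Let V_ge0 : 0 <= V.
Proof.
by rewrite le_max mulr_ge0 ?pos_coef_ge0//; exact: running_max_ge0.
Qed.

Let term_le k (i : nat) : (0 < i <= N)%N -> c k * z i%:Z <= V.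
Proof.
move=> iN; have hA : z i%:Z <= A by exact: (running_max_ge 0 (fun i => z i%:Z)).
have hB : - z i%:Z <= B by exact: (running_max_ge 0 (fun i => - z i%:Z)).
have A0 : 0 <= A by exact: running_max_ge0.
have B0 : 0 <= B by exact: running_max_ge0.
have hp := pos_coef_ge k; have hm := neg_coef_ge k.
have p0 := pos_coef_ge0; have m0 := neg_coef_ge0.
rewrite /V le_max; have [z0|z0] := leP 0 (z i%:Z); apply/orP; [left|right].
  by apply: (@le_trans _ _ (pos_coef * z i%:Z)); [exact: ler_wpM2r|exact: ler_wpM2l].
rewrite -mulrNN; apply: (@le_trans _ _ (neg_coef * - z i%:Z)).
  by rewrite ler_wpM2r// oppr_ge0 ltW.
exact: ler_wpM2l.
Qed.

Let start_small : `|moving_sum 1| <= weight * kappa.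
Proof. by apply: moving_sum_small => k; apply: edge_start; have := ltn_ord k; lia. Qed.

Let wk0 : 0 <= weight * kappa. Proof. by rewrite mulr_ge0// weight_ge0. Qed.

(** A window of [q.+1] innovations contains at most one large one, so every
    moving sum is a single term up to the small ones. *)
Lemma moving_max_le : G <= V + weight * kappa.
Proof.
apply/running_max_leP; split.
  by rewrite (le_trans (ler_norm _))// (le_trans start_small)// lerDr.
move=> t tN; have [[k0 big]|small] :=
    pselect (exists k : 'I_q.+1, kappa < `|z (t%:Z - (k : nat)%:Z)|); last first.
  have : `|moving_sum t%:Z| <= weight * kappa.
    apply: moving_sum_small => k; rewrite leNgt; apply/negP => h.
    by apply: small; exists k.
  by rewrite ler_norml => /andP[_ h]; rewrite (le_trans h)// lerDr.
have k0q := ltn_ord k0.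
have others k : k != k0 -> `|z (t%:Z - (k : nat)%:Z)| <= kappa.
  move=> kk0; have kq := ltn_ord k; have {}kk0 : (k : nat) != k0 by [].
  have [lt|ge] := ltnP k k0.
    by apply: (separated _ _ _ _ big); lia.
  rewrite leNgt; apply/negP => big'.
  have : `|z (t%:Z - (k0 : nat)%:Z)| <= kappa by apply: (separated _ _ _ _ big'); lia.
  by rewrite leNgt big.
have t1 : 1 < t%:Z - (k0 : nat)%:Z.
  rewrite ltNge; apply/negP => h; move: big; apply/negP; rewrite -leNgt.
  by apply: edge_start => //; lia.
have [i iE] : exists i : nat, t%:Z - (k0 : nat)%:Z = i%:Z.
  by exists (t - k0)%N; lia.
have iN : (0 < i <= N)%N by lia.
have := moving_sum_near_term others; rewrite iE ler_norml => /andP[_ h].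
by have := term_le k0 iN; lra.
Qed.

(** Conversely a large innovation at [i] meets the coefficient [c k] in the moving
    sum at time [i + k], which is at most [N] because no large innovation occurs
    in the last window. *)
Lemma moving_max_ge : V <= G + 2 * (weight * kappa).
Proof.
have w0 := wk0.
have G0 : - (weight * kappa) <= G.
  have := start_small; rewrite ler_norml => /andP[h _].
  by apply: (le_trans h); exact: running_max_ge0.
have key k (i : nat) : (0 < i <= N)%N -> c k * z i%:Z <= G + 2 * (weight * kappa).
  move=> iN; have [small|big] := leP `|z i%:Z| kappa.
    have : c k * z i%:Z <= weight * kappa.
      rewrite (le_trans (ler_norm _))// normrM ler_pM//.
      by rewrite /weight (bigD1 k)//= lerDl sumr_ge0.
    lra.
  have iNq : i%:Z <= N%:Z - q%:Z.
    rewrite leNgt; apply/negP => h; move: big; apply/negP; rewrite -leNgt.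
    by apply: edge_end => //; lia.
  have kq := ltn_ord k.
  have iE : (i + k)%N%:Z - (k : nat)%:Z = i%:Z by lia.
  have : `|moving_sum (i + k)%N%:Z - c k * z i%:Z| <= weight * kappa.
    rewrite -iE; apply: moving_sum_near_term => k' kk'.
    have k'q := ltn_ord k'; have {}kk' : (k' : nat) != k by [].
    have [lt|ge] := ltnP k' k.
      by apply: (separated _ _ _ _ big); lia.
    rewrite leNgt; apply/negP => big'.
    have : `|z i%:Z| <= kappa by apply: (separated _ _ _ _ big'); lia.
    by rewrite leNgt big.
  rewrite ler_norml => /andP[h _].
  have : moving_sum (i + k)%N%:Z <= G.
    by apply: (running_max_ge _ (fun i => moving_sum i%:Z)); lia.
  lra.
have y0 : 0 <= G + 2 * (weight * kappa) by lra.
rewrite /V ge_max; apply/andP; split.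
- have [p0|p0] := leP pos_coef 0.
    by rewrite (le_trans _ y0)// mulr_le0_ge0//; exact: running_max_ge0.
  rewrite mulrC -ler_pdivlMr//; apply/running_max_leP; split.
    by rewrite divr_ge0// ltW.
  move=> i iN; have [z0|z0] := leP (z i%:Z) 0.
    by rewrite (le_trans z0)// divr_ge0// ltW.
  rewrite ler_pdivlMr// mulrC -ler_pdivlMr//; apply/bigmax_leP; split.
    by rewrite divr_ge0// ltW.
  move=> k _; rewrite ge_max divr_ge0 ?(ltW z0)// andbT ler_pdivlMr//.
  exact: key.
- have [p0|p0] := leP neg_coef 0.
    by rewrite (le_trans _ y0)// mulr_le0_ge0//; exact: running_max_ge0.
  rewrite mulrC -ler_pdivlMr//; apply/running_max_leP; split.
    by rewrite divr_ge0// ltW.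
  move=> i iN; have [z0|z0] := leP (- z i%:Z) 0.
    by rewrite (le_trans z0)// divr_ge0// ltW.
  rewrite ler_pdivlMr// mulrC -ler_pdivlMr//; apply/bigmax_leP; split.
    by rewrite divr_ge0// ltW.
  move=> k _; rewrite ge_max divr_ge0 ?(ltW z0)// andbT ler_pdivlMr// mulrNN.
  exact: key.
Qed.

Lemma moving_max_near : `|G - V| <= 2 * (weight * kappa).
Proof.
have h1 := moving_max_le; have h2 := moving_max_ge; have h3 := wk0.
by rewrite ler_norml; apply/andP; split; lra.
Qed.

End one_big_jump.

(** * Regularly varying tails along the norming sequence *)

Section regular_variation.
Context {R : realType} d (T : measurableType d) (P : probability T R).
Context (zeta : T -> R) (mzeta : measurable_fun setT zeta).
Context (alpha : R) (L : R -> R) (a : nat -> R).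
Hypothesis L_slow : slowly_varying L.
Hypothesis zeta_tail : forall x, 0 < x ->
  P [set w | x < `|zeta w|] = (x `^ (- alpha) * L x)%:E.
Hypothesis a_gt0 : forall n, 0 < a n.
Hypothesis a_norm : n%:R * fine (P [set w | a n < `|zeta w|]) @[n --> \oo] --> (1 : R).

Definition abs_tail (x : R) : R := prob P [set w | x < `|zeta w|].
Definition right_tail (x : R) : R := prob P [set w | x < zeta w].
Definition left_tail (x : R) : R := prob P [set w | zeta w < - x].

Lemma abs_tailE x : 0 < x -> abs_tail x = x `^ (- alpha) * L x.
Proof. by move=> x0; rewrite /abs_tail /prob zeta_tail. Qed.

Lemma abs_tail_gt0 x : 0 < x -> 0 < abs_tail x.
Proof.
by move=> x0; rewrite abs_tailE// mulr_gt0 ?powR_gt0//; case: L_slow => _ + _; apply.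
Qed.

Lemma measurable_abs_tail x : measurable [set w | x < `|zeta w|].
Proof. by apply: measurable_superlevel; exact: measurableT_comp. Qed.

(** Were [a n] bounded along a subsequence, the tail there would stay away from
    zero and its product with [n] would diverge. *)
Lemma norming_dvg : a n @[n --> \oo] --> +oo.
Proof.
apply/cvgryPgt => K0; pose K := Num.max K0 1.
have K_gt0 : 0 < K by rewrite lt_max ltr01 orbT.
have tK := abs_tail_gt0 K_gt0.
have /cvgrPdist_lt/(_ 1 ltr01) an := a_norm.
near=> n; rewrite (@le_lt_trans _ _ K)// ?le_max ?lexx// ltNge; apply/negP => aK.
have h1 : `|1 - n%:R * fine (P [set w | a n < `|zeta w|])| < 1 by near: n.
have h2 : 2 / abs_tail K < n%:R by near: n; exact: nbhs_infty_gtr.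
have h3 : abs_tail K <= fine (P [set w | a n < `|zeta w|]).
  apply: prob_le; [exact: measurable_abs_tail|exact: measurable_abs_tail|].
  by move=> w /=; exact: le_lt_trans.
rewrite ltr_pdivrMr// in h2.
have h4 : n%:R * abs_tail K <= n%:R * fine (P [set w | a n < `|zeta w|]).
  by rewrite ler_wpM2l.
by rewrite ltr_norml in h1; case/andP: h1; lra.
Unshelve. all: by end_near. Qed.

Lemma norming_scaled_dvg x : 0 < x -> x * a n @[n --> \oo] --> +oo.
Proof.
move=> x0; apply/cvgryPgt => K.
have /cvgryPgt/(_ (K / x)) := norming_dvg.
by apply: filterS => n; rewrite ltr_pdivrMr// mulrC.
Qed.

(** Slow variation makes the ratio of the tails at [x * a n] and at [a n] converge
    to a power of [x], and the norming fixes the scale. *)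
Lemma abs_tail_cvg x : 0 < x ->
  n%:R * abs_tail (x * a n) @[n --> \oo] --> x `^ (- alpha).
Proof.
move=> x0; have [mL L0 Lc] := L_slow.
have h : n%:R * abs_tail (a n) * (x `^ (- alpha) * (L (x * a n) / L (a n))) @[n --> \oo]
    --> 1 * (x `^ (- alpha) * 1).
  apply: cvgM; first exact: a_norm.
  apply: cvgM; first exact: cvg_cst.
  exact: (cvg_comp _ _ norming_dvg (Lc x x0)).
rewrite mul1r mulr1 in h; apply: cvg_trans h; apply: near_eq_cvg.
near=> n; have an := a_gt0 n; rewrite !abs_tailE ?mulr_gt0// powRM ?(ltW x0) ?(ltW an)//.
by field; rewrite gt_eqF// L0.
Unshelve. all: by end_near. Qed.

Lemma right_tail_cvg (p x : R) : 0 < x ->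
  fine (P [set w | x < zeta w]) / fine (P [set w | x < `|zeta w|]) @[x --> +oo] --> p ->
  n%:R * right_tail (x * a n) @[n --> \oo] --> p * x `^ (- alpha).
Proof.
move=> x0 hp; have H : right_tail (x * a n) / abs_tail (x * a n) * (n%:R * abs_tail (x * a n)) @[n --> \oo]
    --> p * x `^ (- alpha).
  exact: (cvgM (cvg_comp _ _ (norming_scaled_dvg x0) hp) (abs_tail_cvg x0)).
apply: cvg_trans H; apply: near_eq_cvg; near=> n.
have := abs_tail_gt0 (mulr_gt0 x0 (a_gt0 n)); move=> h.
by field; rewrite gt_eqF.
Unshelve. all: by end_near. Qed.

Lemma left_tail_cvg (r x : R) : 0 < x ->
  fine (P [set w | zeta w < - x]) / fine (P [set w | x < `|zeta w|]) @[x --> +oo] --> r ->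
  n%:R * left_tail (x * a n) @[n --> \oo] --> r * x `^ (- alpha).
Proof.
move=> x0 hp; have H : left_tail (x * a n) / abs_tail (x * a n) * (n%:R * abs_tail (x * a n)) @[n --> \oo]
    --> r * x `^ (- alpha).
  exact: (cvgM (cvg_comp _ _ (norming_scaled_dvg x0) hp) (abs_tail_cvg x0)).
apply: cvg_trans H; apply: near_eq_cvg; near=> n.
have := abs_tail_gt0 (mulr_gt0 x0 (a_gt0 n)); move=> h.
by field; rewrite gt_eqF.
Unshelve. all: by end_near. Qed.

End regular_variation.

(** * Negligible configurations of large innovations *)

Section independence.
Context {R : realType} d (T : measurableType d) (P : probability T R).

Lemma mutually_independent_seq d' (S : measurableType d') (I : choiceType)
    (X : I -> T -> S) (s : seq I) (B : I -> set S) :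
  (forall i, measurable_fun setT (X i)) -> mutually_independent P X ->
  uniq s -> (forall i, measurable (B i)) ->
  prob P [set w | forall i, i \in s -> B i (X i w)] =
  \prod_(i <- s) prob P (X i @^-1` B i).
Proof.
move=> mX indX us mB; apply: EFin_inj.
have mXB i : measurable (X i @^-1` B i).
  by rewrite -[Z in measurable Z]setTI; apply: mX.
pose J := [fset x | x in s]%fset.
have Js : perm_eq (enum_fset J) s.
  apply: uniq_perm => // x.
  by apply/imfsetP/idP => [[y + ->]|xs]; [|exists x].
have <- : \bigcap_(i in [set` J]) (X i @^-1` B i) =
    [set w | forall i, i \in s -> B i (X i w)].
  apply/seteqP; split=> w /= h i; first by rewrite -(perm_mem Js); exact: h.
  by move=> iJ; apply: h; rewrite -(perm_mem Js).
rewrite probK; last by apply: fin_bigcap_measurable.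
rewrite indX// (perm_big _ Js)/=.
elim: s {us J Js} => [|i s IH]; first by rewrite !big_nil.
by rewrite !big_cons EFinM IH probK.
Qed.

End independence.

Section crowded_events.
Context {R : realType} d (T : measurableType d) (P : probability T R).
Context (Z : int -> T -> R).
Hypothesis mZ : forall i, measurable_fun setT (Z i).
Hypothesis Z_indep : mutually_independent P Z.
Hypothesis Z_ident : identically_distributed P Z.

Definition large (kappa : R) (i : int) : set T := [set w | kappa < `|Z i w|].

Let tau (kappa : R) : R := abs_tail P (Z 1) kappa.

Lemma measurable_large kappa i : measurable (large kappa i).
Proof. by apply: measurable_superlevel; exact: measurableT_comp. Qed.

Let measurable_norm_gt (kappa : R) : measurable [set x : R | kappa < `|x|].
Proof.
rewrite (_ : [set x | _] = setT `&` (@Num.norm _ R) @^-1` `]kappa, +oo[%classic).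
  exact: normr_measurable.
by apply/seteqP; split=> x; rewrite /= in_itv/= andbT// => -[].
Qed.

Lemma prob_large kappa i : prob P (large kappa i) = tau kappa.
Proof.
rewrite /tau /abs_tail /prob; congr fine.
have mB := measurable_norm_gt kappa.
exact: (Z_ident i 1 mB).
Qed.

Lemma prob_large2 kappa i j : i != j ->
  prob P (large kappa i `&` large kappa j) = tau kappa ^+ 2.
Proof.
move=> ij; have mB := measurable_norm_gt kappa.
have := mutually_independent_seq (s := [:: i; j]) mZ Z_indep _ (fun _ => mB).
rewrite /= inE ij => /(_ isT); rewrite !big_cons big_nil mulr1 expr2.
rewrite -{1}(prob_large kappa i) -(prob_large kappa j) => <-; congr (prob P _).
apply/seteqP; split=> w /=; first by move=> [wi wj] k; rewrite !inE => /orP[] /eqP ->.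
by move=> h; split; apply: h; rewrite !inE eqxx ?orbT.
Qed.

(** Two large innovations within a distance of [q] of each other. *)
Definition crowded (kappa : R) (q n : nat) : set T :=
  \big[setU/set0]_(i < n + q) \big[setU/set0]_(j < q)
    (large kappa (1 - q%:Z + (i : nat)%:Z) `&`
     large kappa (1 - q%:Z + (i : nat)%:Z + (j : nat)%:Z + 1)).

Definition large_in (kappa : R) (b : int) (k : nat) : set T :=
  \big[setU/set0]_(i < k) large kappa (b + (i : nat)%:Z).

(** The configurations in which a partial maximum may differ from the maximum of
    the weighted innovations: a crowded pair, a large innovation in the window of
    the first moving sum, or one among the last [q] before some [N l], which
    does not meet all the coefficients. *)
Definition exceptional (kappa : R) (q n : nat) (I : finType) (N : I -> nat) : set T :=
  crowded kappa q n `|` large_in kappa (1 - q%:Z) q.+1 `|`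
  \big[setU/set0]_l large_in kappa ((N l)%:Z - q%:Z + 1) q.

Lemma measurable_crowded kappa q n : measurable (crowded kappa q n).
Proof.
apply: bigsetU_measurable => i _; apply: bigsetU_measurable => j _.
by apply: measurableI; exact: measurable_large.
Qed.

Lemma measurable_large_in kappa b k : measurable (large_in kappa b k).
Proof. by apply: bigsetU_measurable => i _; exact: measurable_large. Qed.

Lemma measurable_exceptional kappa q n (I : finType) (N : I -> nat) :
  measurable (exceptional kappa q n N).
Proof.
apply: measurableU.
  by apply: measurableU; [exact: measurable_crowded|exact: measurable_large_in].
by apply: bigsetU_measurable => i _; exact: measurable_large_in.
Qed.

Lemma prob_large_in kappa b k : prob P (large_in kappa b k) <= k%:R * tau kappa.
Proof.
apply: le_trans (prob_bigsetU P _ _) _ => [i|]; first exact: measurable_large.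
under eq_bigr do rewrite prob_large.
by rewrite sumr_const card_ord mulr_natl.
Qed.

Lemma prob_crowded kappa q n :
  prob P (crowded kappa q n) <= (n + q)%:R * (q%:R * tau kappa ^+ 2).
Proof.
have mij i j : measurable (large kappa (1 - q%:Z + (i : nat)%:Z) `&`
     large kappa (1 - q%:Z + (i : nat)%:Z + (j : nat)%:Z + 1)).
  by apply: measurableI; exact: measurable_large.
apply: le_trans (prob_bigsetU P _ _) _ => [i|].
  by apply: bigsetU_measurable => j _; exact: mij.
rewrite mulr_natl -[X in _ *+ X](card_ord (n + q)) -sumr_const.
apply: ler_sum => i _; apply: le_trans (prob_bigsetU P _ _) _ => [j|].
  exact: mij.
rewrite mulr_natl -[X in _ *+ X](card_ord q) -sumr_const.
by apply: ler_sum => j _; rewrite prob_large2//; lia.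
Qed.

(** There are of the order of [n] possible crowded pairs, each of which costs a
    squared tail; the other configurations cost boundedly many tails. *)
Lemma prob_exceptional kappa q n (I : finType) (N : I -> nat) :
  prob P (exceptional kappa q n N) <=
  (n + q)%:R * (q%:R * tau kappa ^+ 2) + q.+1%:R * tau kappa +
  #|I|%:R * (q%:R * tau kappa).
Proof.
have mN : measurable (\big[setU/set0]_l large_in kappa ((N l)%:Z - q%:Z + 1) q).
  by apply: bigsetU_measurable => l _; exact: measurable_large_in.
rewrite (le_trans (prob_leU _ _ _))//.
  by apply: measurableU; [exact: measurable_crowded|exact: measurable_large_in].
rewrite lerD//.
  rewrite (le_trans (prob_leU _ _ _))//; [exact: measurable_crowded|exact: measurable_large_in|].
  by rewrite lerD// ?prob_crowded// prob_large_in.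
apply: le_trans (prob_bigsetU P _ _) _ => [l|]; first exact: measurable_large_in.
rewrite mulr_natl -sumr_const; apply: ler_sum => l _; exact: prob_large_in.
Qed.

Lemma notin_large_in kappa b k w : ~ large_in kappa b k w ->
  forall i : int, b <= i -> i < b + k%:Z -> `|Z i w| <= kappa.
Proof.
move=> h i bi ib; rewrite leNgt; apply/negP => big; apply: h.
have [j jE] : exists j : nat, i = b + j%:Z by exists (absz (i - b)%R); lia.
have jk : (j < k)%N by lia.
rewrite /large_in -(bigcup_mkord k (fun j => large kappa (b + j%:Z))).
by exists j => //; rewrite -jE.
Qed.

Lemma notin_crowded kappa q n w : ~ crowded kappa q n w ->
  forall i j : int, 1 - q%:Z <= i -> i < j -> j <= n%:Z ->
  j - i <= q%:Z -> kappa < `|Z i w| -> `|Z j w| <= kappa.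
Proof.
move=> h i j qi ij jn jiq big; rewrite leNgt; apply/negP => big'; apply: h.
have [s sE] : exists s : nat, i = 1 - q%:Z + s%:Z by exists (absz (i - (1 - q%:Z))%R); lia.
have [t tE] : exists t : nat, j = 1 - q%:Z + s%:Z + t%:Z + 1 by exists (absz (j - i - 1)%R); lia.
have sn : (s < n + q)%N by lia.
have tq : (t < q)%N by lia.
rewrite /crowded -(bigcup_mkord (n + q) (fun i => \big[setU/set0]_(j < q)
    (large kappa (1 - q%:Z + i%:Z) `&` large kappa (1 - q%:Z + i%:Z + (j : nat)%:Z + 1)))).
exists s => //=; rewrite -(bigcup_mkord q (fun j =>
    large kappa (1 - q%:Z + s%:Z) `&` large kappa (1 - q%:Z + s%:Z + j%:Z + 1))).
by exists t => //; split; rewrite /large/= -?tE -?sE.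
Qed.

End crowded_events.

Section approximation.
Context {R : realType} d (T : measurableType d) (P : probability T R).
Context (Z : int -> T -> R) (q : nat) (C : 'I_q.+1 -> T -> R).
Hypothesis mZ : forall i, measurable_fun setT (Z i).
Hypothesis mC : forall i, measurable_fun setT (C i).
Hypothesis Z_indep : mutually_independent P Z.
Hypothesis Z_ident : identically_distributed P Z.

Lemma measurable_bigmax (J : Type) (s : seq J) (x0 : T -> R) (F : J -> T -> R) :
  measurable_fun setT x0 -> (forall j, measurable_fun setT (F j)) ->
  measurable_fun setT (fun w => \big[Num.max/x0 w]_(j <- s) F j w).
Proof.
move=> m0 mF; elim: s => [|j s IH].
  by under eq_fun do rewrite big_nil.
by under eq_fun do rewrite big_cons; exact: measurable_maxr.
Qed.

Lemma measurable_running_max (x0 : T -> R) (F : nat -> T -> R) N :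
  measurable_fun setT x0 -> (forall j, measurable_fun setT (F j)) ->
  measurable_fun setT (fun w => running_max (x0 w) (F^~ w) N).
Proof. by move=> m0 mF; exact: measurable_bigmax. Qed.

Lemma measurable_moving_sum t : measurable_fun setT (fun w => moving_sum (C^~ w) (Z^~ w) t).
Proof. by apply: measurable_sum => k; exact: measurable_funM. Qed.

Lemma measurable_pos_coef : measurable_fun setT (fun w => pos_coef (C^~ w)).
Proof. by apply: measurable_bigmax => // k; exact: measurable_maxr. Qed.

Lemma measurable_neg_coef : measurable_fun setT (fun w => neg_coef (C^~ w)).
Proof.
by apply: measurable_bigmax => // k; apply: measurable_maxr => //; exact: measurableT_comp.
Qed.

Lemma measurable_weight : measurable_fun setT (fun w => weight (C^~ w)).
Proof. by apply: measurable_sum => k; exact: measurableT_comp. Qed.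

Lemma tight (f : T -> R) (e : R) : measurable_fun setT f -> 0 < e ->
  exists2 K : R, 0 < K & prob P [set w | K < f w] < e.
Proof.
move=> mf e0; pose F (n : nat) := ~` [set w | n.+1%:R < f w].
have mF n : measurable (F n) by apply: measurableC; exact: measurable_superlevel.
have ndF : nondecreasing_seq F.
  move=> n m nm; apply/subsetPset; apply: subsetC => w /=; apply: le_lt_trans.
  by rewrite ler_nat ltnS.
have FT : \bigcup_n F n = setT.
  apply/seteqP; split=> // w _; exists (Num.truncn `|f w|) => //=.
  apply/negP; rewrite -leNgt (le_trans (ler_norm _))// ltW//.
  exact: truncnS_gt.
have /cvgrPdist_lt/(_ e e0) := prob_cvg_bigcup (P := P) mF ndF.
rewrite FT probT => -[n _ /(_ n (leqnn n))/=]; exists n.+1%:R => //.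
have := probD P measurableT (mF n); rewrite setTI probT setTD setCK => ->.
by apply: le_lt_trans (ler_norm _) _.
Qed.

Context (alpha : R) (L : R -> R) (a : nat -> R).
Hypothesis L_slow : slowly_varying L.
Hypothesis Z_tail : forall x, 0 < x ->
  P [set w | x < `|Z 1 w|] = (x `^ (- alpha) * L x)%:E.
Hypothesis a_gt0 : forall n, 0 < a n.
Hypothesis a_norm : n%:R * fine (P [set w | a n < `|Z 1 w|]) @[n --> \oo] --> (1 : R).

Lemma cvg_invn : (n%:R^-1 : R) @[n --> \oo] --> (0 : R).
Proof.
apply/gtr0_cvgV0; first by near=> n; rewrite ltr0n; near: n; exact: nbhs_infty_gt.
exact: cvgr_idn.
Unshelve. all: by end_near. Qed.

Lemma prob_exceptional_cvg0 (e : R) (I : finType) (N : nat -> I -> nat) : 0 < e ->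
  prob P (exceptional Z (e * a n) q n (N n)) @[n --> \oo] --> (0 : R).
Proof.
move=> e0; pose tau n := abs_tail P (Z 1) (e * a n).
have ntau : n%:R * tau n @[n --> \oo] --> e `^ (- alpha).
  exact: (abs_tail_cvg (mZ 1) L_slow Z_tail a_gt0 a_norm e0).
have tau0 : tau n @[n --> \oo] --> (0 : R).
  have H : n%:R^-1 * (n%:R * tau n) @[n --> \oo] --> 0 * e `^ (- alpha).
    by apply: cvgM => //; exact: cvg_invn.
  rewrite mul0r in H; apply: cvg_trans H; apply: near_eq_cvg; near=> n.
  by rewrite mulKf// pnatr_eq0 -lt0n; near: n; exact: nbhs_infty_gt.
pose bound n := q%:R * ((n%:R * tau n) * tau n) + q%:R * q%:R * (tau n * tau n) +
  q.+1%:R * tau n + #|I|%:R * (q%:R * tau n).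
have b0 : bound n @[n --> \oo] --> (0 : R).
  rewrite (_ : 0 = q%:R * (e `^ (- alpha) * 0) + q%:R * q%:R * (0 * 0) +
    q.+1%:R * 0 + #|I|%:R * (q%:R * 0) :> R); last by rewrite !mulr0 !addr0.
  apply: cvgD.
    apply: cvgD; last by apply: cvgM => //; exact: cvg_cst.
    apply: cvgD; apply: cvgM; try exact: cvg_cst; exact: cvgM.
  apply: cvgM; first exact: cvg_cst.
  by apply: cvgM => //; exact: cvg_cst.
apply: (@squeeze_cvgr _ _ _ _ (cst 0) bound) => //; last exact: cvg_cst.
apply: nearW => n; rewrite prob_ge0/=.
apply: le_trans (prob_exceptional mZ Z_indep Z_ident _ _ _ _) _.
rewrite /bound -/(tau n) natrD; lra.
Unshelve. all: by end_near. Qed.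

Definition scaled_max n (N : nat) (w : T) : R :=
  (a n)^-1 * running_max (moving_sum (C^~ w) (Z^~ w) 1)
    (fun i => moving_sum (C^~ w) (Z^~ w) i%:Z) N.

Definition scaled_pos n (N : nat) (w : T) : R :=
  (a n)^-1 * running_max 0 (fun i => Z i%:Z w) N.

Definition scaled_neg n (N : nat) (w : T) : R :=
  (a n)^-1 * running_max 0 (fun i => - Z i%:Z w) N.

(** The moving sums enter only through the extreme coefficients, which multiply
    the extremes of the innovations; both factors are independent. *)
Definition decoupled_max n (N : nat) (w : T) : R :=
  Num.max (pos_coef (C^~ w) * scaled_pos n N w) (neg_coef (C^~ w) * scaled_neg n N w).

Lemma measurable_scaled_max n N : measurable_fun setT (scaled_max n N).
Proof.
apply: measurable_funM => //; apply: measurable_running_max; first exact: measurable_moving_sum.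
by move=> i; exact: measurable_moving_sum.
Qed.

Lemma measurable_scaled_pos n N : measurable_fun setT (scaled_pos n N).
Proof.
apply: measurable_funM => //; apply: (measurable_running_max (x0 := cst 0)) => // i.
Qed.

Lemma measurable_scaled_neg n N : measurable_fun setT (scaled_neg n N).
Proof.
apply: measurable_funM => //; apply: (measurable_running_max (x0 := cst 0)) => // i.
exact: measurableT_comp.
Qed.

Lemma measurable_decoupled_max n N : measurable_fun setT (decoupled_max n N).
Proof.
apply: measurable_maxr; apply: measurable_funM.
- exact: measurable_pos_coef.
- exact: measurable_scaled_pos.
- exact: measurable_neg_coef.
- exact: measurable_scaled_neg.
Qed.

Lemma scaled_max_near n (e : R) (I : finType) (N : I -> nat) w l : 0 < e ->
  (N l <= n)%N -> ~ exceptional Z (e * a n) q n N w ->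
  `|scaled_max n (N l) w - decoupled_max n (N l) w| <= 2 * weight (C^~ w) * e.
Proof.
move=> e0 Nn good; have an := a_gt0 n.
have k0 : 0 <= e * a n by rewrite mulr_ge0// ltW.
have g1 : ~ crowded Z (e * a n) q n w by move=> h; apply: good; left; left.
have g2 : ~ large_in Z (e * a n) (1 - q%:Z) q.+1 w by move=> h; apply: good; left; right.
have g3 : ~ large_in Z (e * a n) ((N l)%:Z - q%:Z + 1) q w.
  move=> h; apply: good; right; rewrite -bigcup_seq/=.
  by exists l => //=; rewrite mem_index_enum.
have h := @moving_max_near R q (C^~ w) (Z^~ w) (e * a n) k0 n (N l) Nn
  (notin_crowded g1) _ _.
have {}h := h _ _; rewrite /scaled_max /decoupled_max /scaled_pos /scaled_neg.
rewrite !(mulrCA _ (a n)^-1) -maxr_pMr ?invr_ge0 ?(ltW an)// -mulrBr normrM.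
rewrite (ger0_norm (x := (a n)^-1)) ?invr_ge0 ?(ltW an)// mulrC ler_pdivrMr//.
rewrite -!mulrA; apply: h => i h1 h2.
- by apply: (notin_large_in g2); lia.
- by apply: (notin_large_in g3); lia.
Qed.

(** Outside the exceptional events the error is at most a multiple of the random
    total weight, which is tight; the thresholds [e * a n] make the exceptional
    events negligible for every fixed [e]. *)
Lemma scaled_max_approx (I : finType) (N : nat -> I -> nat) (h : R) :
  (forall n l, (N n l <= n)%N) -> 0 < h ->
  prob P [set w | exists l, h < `|scaled_max n (N n l) w - decoupled_max n (N n l) w|]
    @[n --> \oo] --> (0 : R).
Proof.
move=> Nn h0; apply/cvgrPdist_lt => e e0.
have e2 : 0 < e / 2 by rewrite divr_gt0.
have [K K0 hK] := tight measurable_weight e2.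
(* for this threshold the error is at most [h] while the weight is at most [K] *)
have d0 : 0 < h / (2 * K) by rewrite divr_gt0// mulr_gt0.
have /cvgrPdist_lt/(_ _ e2) := prob_exceptional_cvg0 N d0.
apply: filterS => n; rewrite !sub0r !normrN !ger0_norm ?prob_ge0// => hn.
have mE : measurable (exceptional Z (h / (2 * K) * a n) q n (N n)).
  exact: measurable_exceptional.
have mW : measurable [set w | K < weight (C^~ w)].
  by apply: measurable_superlevel; exact: measurable_weight.
apply: (@le_lt_trans _ _ (prob P (exceptional Z (h / (2 * K) * a n) q n (N n) `|`
  [set w | K < weight (C^~ w)]))); last first.
  by rewrite (le_lt_trans (prob_leU _ mE mW))//; lra.
apply: prob_le.
- rewrite (_ : [set w | _] = \bigcup_(l in [set: I])
      [set w | h < `|scaled_max n (N n l) w - decoupled_max n (N n l) w|]).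
    apply: fin_bigcup_measurable => [|l _]; first exact: finite_finset.
    apply: measurable_superlevel; apply: measurableT_comp => //.
    apply: measurable_funB; [exact: measurable_scaled_max|exact: measurable_decoupled_max].
  by apply/seteqP; split=> w; [move=> [l hl]; exists l|move=> [l _ hl]; exists l].
- exact: measurableU.
- move=> w [l hl]; have [wE|wE] := pselect (exceptional Z (h / (2 * K) * a n) q n (N n) w).
    by left.
  right => /=; rewrite ltNge; apply/negP => wK.
  move: hl; apply/negP; rewrite -leNgt (le_trans (scaled_max_near d0 (Nn n l) wE))//.
  apply: (@le_trans _ _ (2 * K * (h / (2 * K)))).
    by rewrite ler_wpM2r ?(ltW d0)// ler_wpM2l.
  by rewrite mulrC divfK// gt_eqF// mulr_gt0.
Qed.

End approximation.

(** * Joint distribution of the extremes of the innovations *)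

Section exponential_limit.
Context {R : realType}.

(** Both bounds are [1 + u <= expR u], for [u = - t] and for [u = t / (1 - t)], the
    latter because [(1 - t)^-1 = 1 + t / (1 - t)]. *)
Lemma expR_bounds (t : R) (k : nat) : t < 1 ->
  expR (- (k%:R * t / (1 - t))) <= (1 - t) ^+ k <= expR (- (k%:R * t)).
Proof.
move=> t1; have s0 : 0 < 1 - t by rewrite subr_gt0.
have -> : - (k%:R * t / (1 - t)) = k%:R * - (t / (1 - t)) by rewrite mulrN mulrA.
have -> : - (k%:R * t) = k%:R * - t by rewrite mulrN.
rewrite !expRM_natl; apply/andP; split;
  rewrite lerXn2r ?nnegrE ?expR_ge0 ?(ltW s0)//; last exact: expR_ge1Dx.
rewrite expRN invf_ple ?posrE ?expR_gt0//.
rewrite [leLHS](_ : _ = 1 + t / (1 - t)) ?expR_ge1Dx//.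
by field; rewrite gt_eqF.
Qed.

Lemma cvg_expR_pow (t : nat -> R) (k : nat -> nat) (lambda : R) :
  t n @[n --> \oo] --> (0 : R) -> (k n)%:R * t n @[n --> \oo] --> lambda ->
  (1 - t n) ^+ k n @[n --> \oo] --> expR (- lambda).
Proof.
move=> t0 kt.
have u : expR (- ((k n)%:R * t n)) @[n --> \oo] --> expR (- lambda).
  by apply: continuous_cvg; [exact: continuous_expR|exact: cvgN].
have d : (1 - t n)^-1 @[n --> \oo] --> (1 : R).
  rewrite -[X in _ --> X]invr1; apply: cvgV => //.
  by rewrite -[X in _ --> X]subr0; apply: cvgB => //; exact: cvg_cst.
have v : expR (- ((k n)%:R * t n / (1 - t n))) @[n --> \oo] --> expR (- lambda).
  apply: continuous_cvg; first exact: continuous_expR.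
  by apply: cvgN; rewrite -[X in _ --> X]mulr1; exact: cvgM.
apply: squeeze_cvgr v u; near=> n; apply: expR_bounds.
by near: n; apply: (cvgr_lt 0 t0).
Unshelve. all: by end_near. Qed.

Lemma cvg_truncn_ratio (s : R) : 0 <= s ->
  (Num.truncn (n%:R * s))%:R / n%:R @[n --> \oo] --> s.
Proof.
move=> s0; apply: (@squeeze_cvgr _ _ _ _ (fun n => s - n%:R^-1) (cst s)).
- near=> n; have n0' : (0 < n)%N by near: n; exact: nbhs_infty_gt.
  have n0 : 0 < n%:R :> R by rewrite ltr0n.
  have /andP[h1 h2] := truncn_itv (mulr_ge0 (ler0n R n) s0).
  rewrite -natr1 in h2; apply/andP; split; last by rewrite /cst/= ler_pdivrMr// [leRHS]mulrC.
  by rewrite ler_pdivlMr// mulrBl mulVf ?gt_eqF// [s * _]mulrC; lra.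
- by rewrite -[X in _ --> X]subr0; apply: cvgB; [exact: cvg_cst|exact: cvg_invn].
- exact: cvg_cst.
Unshelve. all: by end_near. Qed.

Lemma cvg_prodr (I : Type) (s : seq I) (f : I -> nat -> R) (g : I -> R) :
  (forall i, f i n @[n --> \oo] --> g i) ->
  \prod_(i <- s) f i n @[n --> \oo] --> \prod_(i <- s) g i.
Proof.
move=> fg; elim: s => [|i s IH].
  by rewrite big_nil; under eq_fun do rewrite big_nil; exact: cvg_cst.
by rewrite big_cons; under eq_fun do rewrite big_cons; exact: cvgM.
Qed.

Lemma prod_blocks (N : nat -> nat) (f : nat -> R) k : N 0 = 0 ->
  {homo N : i j / (i <= j)%N} ->
  \prod_(1 <= i < (N k).+1) f i =
  \prod_(l < k) \prod_((N l).+1 <= i < (N l.+1).+1) f i.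
Proof.
move=> N0 ndN; elim: k => [|k IH]; first by rewrite N0 big_geq// big_ord0.
by rewrite big_ord_recr/= -IH -big_cat_nat//= ltnS ndN.
Qed.

End exponential_limit.

Section suffix_minimum.
Context {R : realType} (m : nat).
Implicit Types x : 'I_m.+2 -> R.

(** The level that an innovation of block [j] must respect in order that the
    running maximum stays below [x l] at every later grid point. *)
Definition suffix_min x (j : nat) : R :=
  \big[Num.min/x ord_max]_(l < m.+2 | (j <= l)%N) x l.

Lemma le_suffix_min x j c : (j <= m.+1)%N ->
  c <= suffix_min x j <-> forall l : 'I_m.+2, (j <= l)%N -> c <= x l.
Proof.
move=> jm; rewrite /suffix_min; split; first by move=> /bigmin_geP[_ h] l jl; exact: h.
by move=> h; apply/bigmin_geP; split=> [|l jl]; apply: h.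
Qed.

Lemma suffix_min_gt0 x j : (forall l, 0 < x l) -> 0 < suffix_min x j.
Proof. by move=> x0; apply/bigmin_gtP. Qed.

End suffix_minimum.

Section extremes.
Context {R : realType} d (T : measurableType d) (P : probability T R).
Context (Z : int -> T -> R).
Hypothesis mZ : forall i, measurable_fun setT (Z i).
Hypothesis Z_indep : mutually_independent P Z.
Hypothesis Z_ident : identically_distributed P Z.
Context (alpha p r : R) (L : R -> R) (a : nat -> R).
Hypothesis L_slow : slowly_varying L.
Hypothesis Z_tail : forall x, 0 < x ->
  P [set w | x < `|Z 1 w|] = (x `^ (- alpha) * L x)%:E.
Hypothesis a_gt0 : forall n, 0 < a n.
Hypothesis a_norm : n%:R * fine (P [set w | a n < `|Z 1 w|]) @[n --> \oo] --> (1 : R).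
Hypothesis Z_tail_p : fine (P [set w | x < Z 1 w]) /
  fine (P [set w | x < `|Z 1 w|]) @[x --> +oo] --> p.
Hypothesis Z_tail_r : fine (P [set w | Z 1 w < - x]) /
  fine (P [set w | x < `|Z 1 w|]) @[x --> +oo] --> r.

Lemma prob_itv_tails (b c : R) : 0 < b -> 0 < c ->
  prob P (Z 1 @^-1` `[- c, b]%classic) = 1 - (right_tail P (Z 1) b + left_tail P (Z 1) c).
Proof.
move=> b0 c0; have mR : measurable [set w | b < Z 1 w] by exact: measurable_superlevel.
have mL : measurable [set w | Z 1 w < - c].
  rewrite (_ : [set w | _] = [set w | c < (-%R \o Z 1) w]).
    by apply: measurable_superlevel; exact: measurableT_comp.
  by apply/seteqP; split=> w /=; rewrite ltrNr.
rewrite (_ : _ @^-1` _ = setT `\` ([set w | b < Z 1 w] `|` [set w | Z 1 w < - c])).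
  rewrite probD//; last exact: measurableU.
  rewrite setTI probT probU// (_ : _ `&` _ = set0) ?prob0 ?subr0//.
  by apply/seteqP; split=> w //= [h1 h2]; lra.
apply/seteqP; split=> w; rewrite /= in_itv/=.
  by move=> /andP[h1 h2]; split=> // -[]; apply/negP; rewrite -leNgt.
move=> [_ h]; apply/andP; split; rewrite leNgt; apply/negP => h'; apply: h; first by right.
by left.
Qed.

Lemma interval_prob_cvg (b c s : R) (k : nat -> nat) : 0 < b -> 0 < c ->
  (k n)%:R / n%:R @[n --> \oo] --> s ->
  prob P (Z 1 @^-1` `[- (c * a n), b * a n]%classic) ^+ k n @[n --> \oo] -->
  expR (- (s * (p * b `^ (- alpha) + r * c `^ (- alpha)))).
Proof.
move=> b0 c0 ks.
under eq_fun do rewrite prob_itv_tails ?mulr_gt0//.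
pose t n := right_tail P (Z 1) (b * a n) + left_tail P (Z 1) (c * a n).
have nt : n%:R * t n @[n --> \oo] --> p * b `^ (- alpha) + r * c `^ (- alpha).
  rewrite /t; under eq_fun do rewrite mulrDr.
  apply: cvgD.
    exact: (right_tail_cvg (mZ 1) L_slow Z_tail a_gt0 a_norm b0 Z_tail_p).
  exact: (left_tail_cvg (mZ 1) L_slow Z_tail a_gt0 a_norm c0 Z_tail_r).
apply: cvg_expR_pow.
  have H : n%:R^-1 * (n%:R * t n) @[n --> \oo] -->
      0 * (p * b `^ (- alpha) + r * c `^ (- alpha)).
    by apply: cvgM => //; exact: cvg_invn.
  rewrite mul0r in H; apply: cvg_trans H; apply: near_eq_cvg; near=> n.
  by rewrite mulKf// pnatr_eq0 -lt0n; near: n; exact: nbhs_infty_gt.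
have H : (k n)%:R / n%:R * (n%:R * t n) @[n --> \oo] -->
    s * (p * b `^ (- alpha) + r * c `^ (- alpha)) by exact: (cvgM ks nt).
apply: cvg_trans H; apply: near_eq_cvg; near=> n.
rewrite /= mulrA divfK// pnatr_eq0 -lt0n; near: n; exact: nbhs_infty_gt.
Unshelve. all: by end_near. Qed.

Variable m : nat.

Definition block_end (n l : nat) : nat := Num.truncn (n%:R * (l%:R / m.+1%:R) : R).

Lemma block_end0 n : block_end n 0 = 0.
Proof. by rewrite /block_end mul0r mulr0 truncn0. Qed.

Lemma block_end_last n : block_end n m.+1 = n.
Proof. by rewrite /block_end divff// mulr1 natrK. Qed.

Lemma block_end_homo n : {homo block_end n : i j / (i <= j)%N}.
Proof.
by move=> i j ij; apply: le_truncn; rewrite ler_wpM2l// ler_wpM2r// ler_nat.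
Qed.

Lemma block_end_le n (l : 'I_m.+2) : (block_end n l <= n)%N.
Proof. by rewrite -[leqRHS](block_end_last n) block_end_homo// -ltnS. Qed.

Variables (x y : 'I_m.+2 -> R).
Hypothesis x_gt0 : forall l, 0 < x l.
Hypothesis y_gt0 : forall l, 0 < y l.

(** An innovation is constrained at every grid time from the end of its own block
    on. *)
Let box (n : nat) (j : int) : set R :=
  [set z | forall l : 'I_m.+2, j <= (block_end n l)%:Z -> - (y l * a n) <= z <= x l * a n].

Let measurable_box n j : measurable (box n j).
Proof.
rewrite (_ : box n j = \bigcap_(l in [set l : 'I_m.+2 | j <= (block_end n l)%:Z])
    `[- (y l * a n), x l * a n]%classic).
  apply: fin_bigcap_measurable => [|l _]; first exact: finite_finset.
  exact: measurable_itv.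
by apply/seteqP; split=> z /= h l hl; have := h l hl; rewrite /= in_itv.
Qed.

Let box_block n (l : 'I_m.+1) (i : nat) :
  (block_end n l < i <= block_end n l.+1)%N ->
  box n i%:Z = `[- (suffix_min y l.+1 * a n), suffix_min x l.+1 * a n]%classic.
Proof.
move=> /andP[li il]; have an := a_gt0 n.
have blk (l' : 'I_m.+2) : (i%:Z <= (block_end n l')%:Z) = (l < l')%N.
  rewrite lez_nat; apply/idP/idP => h.
    rewrite ltnNge; apply/negP => h'; move: h; apply/negP; rewrite -ltnNge.
    by apply: leq_ltn_trans li; exact: block_end_homo.
  by apply: (leq_trans il); exact: block_end_homo.
have lm : (l.+1 <= m.+1)%N by [].
have mx z : z / a n <= suffix_min x l.+1 <-> z <= suffix_min x l.+1 * a n by rewrite ler_pdivrMr.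
have my z : - z / a n <= suffix_min y l.+1 <-> - (suffix_min y l.+1 * a n) <= z.
  by rewrite ler_pdivrMr// lerNl.
apply/seteqP; split=> z; rewrite /= in_itv/=.
  move=> h; apply/andP; split.
    apply/my/(le_suffix_min _ _ lm) => l' ll'; rewrite ler_pdivrMr// lerNl.
    by have := h l'; rewrite blk => /(_ ll')/andP[].
  apply/mx/(le_suffix_min _ _ lm) => l' ll'; rewrite ler_pdivrMr//.
  by have := h l'; rewrite blk => /(_ ll')/andP[].
move=> /andP[/my/(le_suffix_min _ _ lm) hy /mx/(le_suffix_min _ _ lm) hx] l'; rewrite blk => ll'.
have := hy l' ll'; have := hx l' ll'; rewrite !ler_pdivrMr// => -> /=.
by rewrite lerNl => ->.
Qed.

Lemma prob_extremes n :
  prob P [set w | forall l : 'I_m.+2, scaled_pos Z a n (block_end n l) w <= x l /\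
                                   scaled_neg Z a n (block_end n l) w <= y l] =
  \prod_(l < m.+1) prob P (Z 1 @^-1` `[- (suffix_min y l.+1 * a n), suffix_min x l.+1 * a n]%classic)
    ^+ (block_end n l.+1 - block_end n l)%N.
Proof.
have an := a_gt0 n.
pose s := [seq i%:Z | i <- index_iota 1 n.+1].
have us : uniq s by rewrite map_inj_uniq ?iota_uniq// => i j [].
rewrite (_ : [set w | _] = [set w | forall j, j \in s -> box n j (Z j w)]); last first.
  apply/seteqP; split=> w /= h.
    move=> _ /mapP[i + ->] l; rewrite mem_index_iota lez_nat => /andP[i0 _] il.
    have [] := h l; rewrite /scaled_pos /scaled_neg !ler_pdivrMl//.
    move=> /running_max_leP[_ hx] /running_max_leP[_ hy].
    have iN : (0 < i <= block_end n l)%N by rewrite i0.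
    rewrite (mulrC (x l)) hx// andbT lerNl (mulrC (y l)); exact: hy.
  have h' (l : 'I_m.+2) i : (0 < i <= block_end n l)%N -> - (y l * a n) <= Z i%:Z w <= x l * a n.
    move=> /andP[i0 il]; apply: h; last by rewrite lez_nat.
    by apply/map_f; rewrite mem_index_iota i0 ltnS (leq_trans il)// block_end_le.
  move=> l; rewrite /scaled_pos /scaled_neg !ler_pdivrMl//; split.
    apply/running_max_leP; split; first by rewrite mulr_ge0// ltW.
    by move=> i /h' /andP[_]; rewrite mulrC.
  apply/running_max_leP; split; first by rewrite mulr_ge0// ltW.
  by move=> i /h' /andP[+ _]; rewrite lerNl mulrC.
rewrite mutually_independent_seq// big_map.
rewrite -{1}(block_end_last n) (prod_blocks _ _ (block_end0 n) (@block_end_homo n)).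
apply: eq_bigr => l _; rewrite big_nat.
under eq_bigr => i hi.
  rewrite (box_block (l := l)); last by rewrite -ltnS.
  rewrite (_ : prob _ _ = prob P (Z 1 @^-1`
    `[- (suffix_min y l.+1 * a n), suffix_min x l.+1 * a n]%classic)); last first.
    by rewrite /prob; congr fine; apply: Z_ident; exact: measurable_itv.
  over.
by rewrite -big_nat prodr_const_nat subSS.
Qed.

(** Each block of indices contributes a factor that is a large power of a
    probability close to one. *)
Lemma prob_extremes_cvg :
  prob P [set w | forall l : 'I_m.+2, scaled_pos Z a n (block_end n l) w <= x l /\
                                   scaled_neg Z a n (block_end n l) w <= y l]
    @[n --> \oo] -->
  \prod_(l < m.+1) expR (- (m.+1%:R^-1 *
     (p * suffix_min x l.+1 `^ (- alpha) + r * suffix_min y l.+1 `^ (- alpha)))).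
Proof.
under eq_fun do rewrite prob_extremes.
apply: cvg_prodr => l; apply: interval_prob_cvg; [exact: suffix_min_gt0|exact: suffix_min_gt0|].
have g0 (k : nat) : 0 <= k%:R / m.+1%:R :> R by rewrite divr_ge0.
have H : (block_end n l.+1)%:R / n%:R - (block_end n l)%:R / n%:R @[n --> \oo] -->
    (l.+1%:R / m.+1%:R - l%:R / m.+1%:R : R).
  exact: (cvgB (cvg_truncn_ratio (g0 l.+1)) (cvg_truncn_ratio (g0 l))).
rewrite (_ : m.+1%:R^-1 = l.+1%:R / m.+1%:R - l%:R / m.+1%:R); last first.
  by rewrite -mulrBl -natrB// subSnn mul1r.
apply: cvg_trans H; apply: near_eq_cvg; apply: nearW => n.
by rewrite /= -mulrBl -natrB ?block_end_homo.
Qed.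

End extremes.

(** * Finite-dimensional distributions of extremal processes *)

Section power_tail.
Context {R : realType}.

Lemma powRN_cvg0 (alpha : R) : 0 < alpha -> x `^ (- alpha) @[x --> +oo] --> (0 : R).
Proof.
move=> al0; apply/cvgrPdist_lt => e e0; near=> x.
have ei0 : 0 <= e^-1 by rewrite invr_ge0 ltW.
have hx : e^-1 `^ alpha^-1 < x by near: x; exact: nbhs_pinfty_gt.
have x0 : 0 <= x by rewrite (le_trans _ (ltW hx))// powR_ge0.
have : (e^-1 `^ alpha^-1) `^ alpha < x `^ alpha.
  by apply: gt0_ltr_powR; rewrite ?nnegrE ?powR_ge0.
rewrite -powRrM mulVf ?gt_eqF// powRr1// => h.
rewrite sub0r normrN ger0_norm ?powR_ge0// powRN.
by rewrite invf_plt ?posrE// (lt_le_trans _ (ltW h))// invr_gt0.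
Unshelve. all: by end_near. Qed.

(** The function [- c * t `^ (- alpha)] is a primitive of the density and vanishes
    at infinity. *)
Lemma power_measure_tail (c alpha x : R) : 0 <= c -> 0 < alpha -> 0 < x ->
  power_measure c alpha `]x, +oo[%classic = (c * x `^ (- alpha))%:E.
Proof.
move=> c0 al0 x0; pose f : R -> R := fun t => c * alpha * t `^ (- alpha - 1).
pose F : R -> R := fun t => - c * t `^ (- alpha).
have dF (t : R) : 0 < t -> is_derive t 1 F (f t).
  move=> t0; have := is_derive1_powR (- alpha) t0 => d1.
  have := is_deriveZ (- c) d1.
  suff -> : - c *: (- alpha * t `^ (- alpha - 1)) = f t by [].
  by rewrite /f scaleNr /GRing.scale/=; ring.
have cf : {within `[x, +oo[, continuous f}.
  apply: derivable_within_continuous => t; rewrite in_itv/= andbT => xt.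
  apply: derivableZ; apply: derivable_powR; rewrite in_itv/= andbT.
  exact: lt_le_trans xt.
transitivity (\int[lebesgue_measure]_(t in `[x, +oo[) (f t)%:E)%E.
  rewrite /power_measure -integral_itv_obnd_cbnd; last first.
    apply/measurable_EFinP; apply: measurable_funTS.
    by apply: measurable_funM => //; exact: measurable_powR.
  apply: eq_integral => t; rewrite inE/= in_itv/= andbT => xt.
  rewrite indicE mem_set ?mulr1//= in_itv/= andbT.
  exact: lt_trans xt.
rewrite (ge0_continuous_FTC2y (F := F) (l := 0))//.
- by rewrite sub0e -EFinN /F mulNr opprK.
- by move=> t xt; rewrite /f !mulr_ge0 ?powR_ge0// ltW.
- rewrite -[X in _ --> X](mulr0 (- c)); apply: cvgM; first exact: cvg_cst.
  exact: powRN_cvg0.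
- by move=> t xt; have [] := dF t (lt_trans x0 xt).
- have /derivable1_diffP/differentiable_continuous := ex_derive (is_derive := dF x x0).
  exact: cvg_at_right_filter.
- move=> t; rewrite in_itv/= andbT => xt; rewrite derive1E.
  by have [_ ->] := dF t (lt_trans x0 xt).
Unshelve. all: by end_near. Qed.

Lemma power_measure_rectangle (c alpha x : R) (I : set R) : 0 <= c -> 0 < alpha -> 0 < x ->
  measurable I ->
  (lebesgue_measure \x power_measure c alpha)%E (I `*` `]x, +oo[%classic : set (R * R)) =
  (lebesgue_measure I * (c * x `^ (- alpha))%:E)%E.
Proof.
move=> c0 al0 x0 mI; rewrite /product_measure1.
transitivity (\int[lebesgue_measure]_s ((\1_I s)%:E * (c * x `^ (- alpha))%:E))%E.
  apply: eq_integral => s _; rewrite indicE /=; have [sI|sI] := boolP (s \in I).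
    by rewrite in_xsectionX// mul1e power_measure_tail.
  by rewrite notin_xsectionX// mul0e /power_measure integral_set0.
rewrite ge0_integralZr ?integral_indic ?setIT//.
- by apply/measurable_EFinP; exact: measurable_indic.
- by rewrite lee_fin mulr_ge0// powR_ge0.
Qed.

End power_tail.

Section extremal_cdf.
Context {R : realType} d (T : measurableType d) (P : probability T R).

Lemma counting_eq0 (A : set nat) : counting A = 0%E :> \bar R <-> A = set0.
Proof.
split=> [|->]; last by rewrite /counting asboolT// fset_set0.
rewrite /counting; case: asboolP => // fA [] /eqP.
rewrite pnatr_eq0 => /eqP/finmap.cardfs0_eq A0.
by rewrite -[LHS](fset_setK fA) A0 set_fset0.
Qed.

Lemma point_count_eq0 (S : Type) (pts : nat -> T -> option S) (B : set S) w :
  point_count pts B w = 0%E :> \bar R <-> forall i s, pts i w = Some s -> ~ B s.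
Proof.
rewrite /point_count counting_eq0; split=> [A0 i s is_ Bs|h].
  by have : set0 i by rewrite -A0; exists s.
by apply/seteqP; split=> // i [s /h].
Qed.

Lemma poisson_void (mu : R) : 0 <= mu -> poisson_prob mu 0 [set 0%N] = (expR (- mu))%:E.
Proof.
move=> mu0; rewrite /poisson_prob; case: ifPn => [m0|].
  rewrite esum_set1 ?lee_fin ?poisson_pmf_ge0//; congr EFin.
  by rewrite /poisson_pmf m0 expr0 fact0 invr1 !mul1r.
rewrite -leNgt => m0; have -> : mu = 0 by apply/eqP; rewrite eq_le m0.
by rewrite oppr0 expR0 diracE mem_set.
Qed.

Section void_probabilities.
Context (nu : set R -> \bar R) (pts : nat -> T -> option (R * R)).
Hypothesis ppp : poisson_point_process P (`[0, 1] `*` `]0, +oo[ : set (R * R))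
  (@lebesgue_measure R \x nu)%E pts.

Lemma running_sup_le (c t : R) w : 0 <= c ->
  (running_sup pts t w <= c%:E)%E <->
  forall i s v, pts i w = Some (s, v) -> s <= t -> v <= c.
Proof.
move=> c0; split=> [h i s v isv st|h].
  rewrite -lee_fin (le_trans _ h)//; apply: ereal_sup_ubound; right.
  by exists v => //; exists i, s.
apply: ge_ereal_sup => _ [->|[v [i [s [isv st]]] <-]]; first by rewrite lee_fin.
by rewrite lee_fin; exact: h isv st.
Qed.

Context (m : nat) (x : 'I_m.+2 -> R).
Hypothesis x_gt0 : forall l, 0 < x l.

(** The strips are open on the left, so time zero needs one of its own; it is
    Lebesgue negligible. *)
Definition time_strip (j : nat) : set R :=
  if j is k.+1 then `]k%:R / m.+1%:R, k.+1%:R / m.+1%:R]%classic else [set 0].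

(** The running supremum respects all the levels [x l] exactly when no point of
    the process falls in any of these disjoint regions. *)
Definition forbidden (j : 'I_m.+2) : set (R * R) :=
  time_strip j `*` `]suffix_min x j, +oo[%classic.

Lemma measurable_time_strip j : measurable (time_strip j).
Proof. by case: j => [|k]; [exact: measurable_set1|exact: measurable_itv]. Qed.

Lemma measurable_forbidden j : measurable (forbidden j).
Proof. by apply: measurableX; [exact: measurable_time_strip|exact: measurable_itv]. Qed.

Lemma time_strip01 (j : 'I_m.+2) : time_strip j `<=` `[0, 1]%classic.
Proof.
case: j => -[|k]/= km s; first by move=> ->; rewrite /= in_itv/= lexx ler01.
rewrite /= !in_itv/= => /andP[ks sk]; rewrite (le_trans _ (ltW ks)) ?divr_ge0//=.
by rewrite (le_trans sk)// ler_pdivrMr// mul1r ler_nat.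
Qed.

Lemma forbidden_sub j : forbidden j `<=` `[0, 1] `*` `]0, +oo[.
Proof.
move=> [s v] [/= sj]; rewrite in_itv/= andbT => jv.
split=> /=; first exact: time_strip01 sj.
by rewrite in_itv/= andbT (lt_trans _ jv)// suffix_min_gt0.
Qed.

Lemma time_strip_unique (j k : nat) s : time_strip j s -> time_strip k s -> j = k.
Proof.
wlog jk : j k / (j < k)%N.
  move=> h js ks; have [/h->//|/h->//|//] := ltngtP j k.
case: k jk => // k jk js; rewrite /= in_itv/= => /andP[ks _].
suff : s <= k%:R / m.+1%:R by rewrite leNgt ks.
have jk' : (j%:R / m.+1%:R : R) <= k%:R / m.+1%:R by rewrite ler_wpM2r// ler_nat.
rewrite (le_trans _ jk')//; case: j js {jk jk'} => [->|j]; first by rewrite mul0r.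
by rewrite /= in_itv/= => /andP[].
Qed.

Lemma trivIset_forbidden : trivIset setT forbidden.
Proof.
move=> j k _ _ [[s v] [[/= sj _] [/= sk _]]].
by apply: val_inj; exact: time_strip_unique sj sk.
Qed.

Lemma time_strip_cover (l : 'I_m.+2) s : 0 <= s -> s <= l%:R / m.+1%:R ->
  exists2 j : 'I_m.+2, (j <= l)%N & time_strip j s.
Proof.
move=> s0 sl; have ex : exists k : nat, s <= k%:R / m.+1%:R by exists l.
have jl := ex_minnP ex; case: jl => j sj minj; have jl : (j <= l)%N by exact: minj.
have jm : (j < m.+2)%N by exact: leq_ltn_trans jl (ltn_ord l).
exists (Ordinal jm) => //=; case: j sj minj {jl jm} => [|j] sj minj.
  by apply/eqP; rewrite eq_le s0 andbT (le_trans sj)// mul0r.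
rewrite /= in_itv/= sj andbT ltNge; apply/negP => /minj.
by rewrite ltnn.
Qed.

Lemma running_sup_void w :
  (forall l, (running_sup pts (grid l) w <= (x l)%:E)%E) <->
  (forall j, point_count pts (forbidden j) w = 0%E :> \bar R).
Proof.
split=> h.
  move=> j; apply/point_count_eq0 => i [s v] isv [/= sj]; rewrite in_itv/= andbT.
  apply/negP; rewrite -leNgt; have jm : (j <= m.+1)%N by rewrite -ltnS.
  apply/(le_suffix_min _ _ jm) => l jl.
  have [+ _] := running_sup_le (grid l) w (ltW (x_gt0 l)).
  move=> /(_ (h l) _ _ _ isv); apply.
  have : s <= grid j.
    case: (j) sj => -[|k] km /=; first by move=> ->; rewrite /grid mul0r.
    by rewrite in_itv/= => /andP[].
  by move/le_trans; apply; rewrite ler_wpM2r// ler_nat.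
move=> l; apply/running_sup_le; first exact: ltW.
move=> i s v isv sl; have [pE _ _ _ _] := ppp.
have [] := pE _ _ _ isv; rewrite /= !in_itv/= => /andP[s0 _] _.
have [j jl sj] := time_strip_cover s0 sl.
have /point_count_eq0/(_ i _ isv) hj := h j; rewrite leNgt; apply/negP => lv.
apply: hj; split=> //=; rewrite in_itv/= andbT (le_lt_trans _ lv)//.
have jm : (j <= m.+1)%N by rewrite -ltnS.
by have /(le_suffix_min x _ jm) := lexx (suffix_min x j); apply.
Qed.

(** A product of void probabilities over the disjoint forbidden regions; the mass
    of each is a mesh times a power tail. *)
Lemma prob_running_sup (c alpha : R) : nu = power_measure c alpha -> 0 <= c -> 0 < alpha ->
  prob P [set w | forall l, (running_sup pts (grid l) w <= (x l)%:E)%E] =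
  \prod_(l < m.+1) expR (- (m.+1%:R^-1 * (c * suffix_min x l.+1 `^ (- alpha)))).
Proof.
move=> nuE c0 al0; have [pE mp voidp _ indp] := ppp.
have mD j := measurable_forbidden j; have sD := forbidden_sub.
rewrite (_ : [set w | _] = [set w | forall j, j \in enum 'I_m.+2 ->
    [set 0%E] (point_count pts (forbidden j) w : \bar R)]); last first.
  apply/seteqP; split=> w /=; first by move=> /running_sup_void h j _; exact: h.
  by move=> h; apply/running_sup_void => j; apply: h; rewrite mem_enum.
rewrite (@mutually_independent_seq _ _ _ P _ _ _
    (fun j w => point_count pts (forbidden j) w : \bar R) _ (fun _ => [set 0%E])).
- have mu_rect j : ((@lebesgue_measure R \x nu) (forbidden j) =
      lebesgue_measure (time_strip j) * (c * suffix_min x j `^ (- alpha))%:E)%E.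
    rewrite nuE power_measure_rectangle//; first exact: suffix_min_gt0.
    exact: measurable_time_strip.
  have w0 (j : nat) : 0 <= c * suffix_min x j `^ (- alpha) by rewrite mulr_ge0// powR_ge0.
  have leb0 : @lebesgue_measure R (time_strip 0) = 0%E by exact: lebesgue_measure_set1.
  have lebS k : @lebesgue_measure R (time_strip k.+1) = (m.+1%:R^-1)%:E.
    rewrite /= lebesgue_measure_itv/= lte_fin ltr_pM2r ?invr_gt0// ltr_nat ltnSn.
    by rewrite -EFinB -mulrBl -natrB// subSnn mul1r.
  (* the strip at time zero contributes the factor [expR 0] *)
  rewrite big_enum/= big_ord_recl [X in X * _](_ : _ = 1) ?mul1r.
    apply: eq_bigr => l _; have := voidp _ (mD (lift ord0 l)) (sD (lift ord0 l)).
    rewrite mu_rect lebS -EFinM => /(_ (ltry _) 0%N) h; rewrite /prob.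
    by rewrite [P _]h/= poisson_void// mulr_ge0// invr_ge0.
  have := voidp _ (mD ord0) (sD ord0).
  rewrite mu_rect leb0 mul0e => /(_ (ltry _) 0%N) h; rewrite /prob.
  by rewrite [P _]h/= poisson_void// oppr0 expR0.
- by move=> j; exact: mp (mD j) (sD j).
- by apply: indp => //; exact: trivIset_forbidden.
- exact: enum_uniq.
- by move=> _; exact: emeasurable_set1.
Qed.

End void_probabilities.

End extremal_cdf.

Section extremal_law.
Context {R : realType} d (T : measurableType d) (P : probability T R).
Context (c alpha : R) (W : T -> Dup R).
Hypothesis W_extremal : extremal_process P (power_measure c alpha) W.

Let measurable_below (m : nat) (x : 'I_m.+2 -> R) (t : R) :
  measurable [set y : \bar R | forall l, t = grid l -> (y <= (x l)%:E)%E].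
Proof.
rewrite (_ : [set y | _] = \bigcap_(l in [set l : 'I_m.+2 | t = grid l])
    [set y : \bar R | (y <= (x l)%:E)%E]); last by apply/seteqP; split.
apply: fin_bigcap_measurable => [|l _]; first exact: finite_finset.
rewrite (_ : [set y | _] = `]-oo, (x l)%:E]%classic); first exact: emeasurable_itv.
by apply/seteqP; split=> y; rewrite /= in_itv.
Qed.

(** The law is given for families of Borel sets indexed by times; the set used at
    time [t] collects the levels of all the indices [l] with [t = grid l], which
    avoids inverting [grid]. *)
Let law_transfer (m : nat) (x : 'I_m.+2 -> R) :
  exists (d0 : measure_display) (T0 : measurableType d0)
         (P0 : probability T0 R) (pts : nat -> T0 -> option (R * R)),
    poisson_point_process P0 (`[0, 1] `*` `]0, +oo[ : set (R * R))
      (@lebesgue_measure R \x (power_measure c alpha))%E pts /\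
    prob P [set w | forall l, W w (grid l) <= x l] =
    prob P0 [set w | forall l, (running_sup pts (grid l) w <= (x l)%:E)%E].
Proof.
have [_ [d0 [T0 [P0 [pts [ppp law]]]]]] := W_extremal.
exists d0, T0, P0, pts; split=> //; rewrite /prob; congr fine.
pose J := [fset grid l | l in 'I_m.+2]%fset : {fset R}.
have J01 : [set` J] `<=` `[0, 1].
  by move=> _ /= /imfsetP[l _ ->]; rewrite /= in_itv/=; exact: grid01.
have := law J _ J01 (fun t => @measurable_below m x t).
have EJ e (S : measurableType e) (V : R -> S -> \bar R) :
    \bigcap_(i in [set` J]) (V i @^-1` [set y | forall l : 'I_m.+2, i = grid l -> (y <= (x l)%:E)%E])
    = [set w | forall l, (V (grid l) w <= (x l)%:E)%E].
  apply/seteqP; split=> w /= h.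
    by move=> l; apply: (h (grid l)) => //=; apply/imfsetP; exists l.
  by move=> t _ l tl; rewrite /= tl; exact: h.
by rewrite !EJ => <-; congr (P _); apply/seteqP; split=> w /= h l; have := h l; rewrite lee_fin.
Qed.

Lemma extremal_cdf (m : nat) (x : 'I_m.+2 -> R) : 0 <= c -> 0 < alpha ->
  (forall l, 0 < x l) ->
  prob P [set w | forall l, W w (grid l) <= x l] =
  \prod_(l < m.+1) expR (- (m.+1%:R^-1 * (c * suffix_min x l.+1 `^ (- alpha)))).
Proof.
move=> c0 al0 x0; have [d0 [T0 [P0 [pts [ppp ->]]]]] := law_transfer x.
exact: (prob_running_sup ppp x0 erefl c0 al0).
Qed.

Lemma extremal_cdf0 (m : nat) (x : 'I_m.+2 -> R) l0 : x l0 < 0 ->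
  prob P [set w | forall l, W w (grid l) <= x l] = 0.
Proof.
move=> x0; have [d0 [T0 [P0 [pts [ppp ->]]]]] := law_transfer x.
rewrite (_ : [set w | _] = set0) ?prob0//; apply/seteqP; split=> w //= /(_ l0).
apply/negP; rewrite -ltNge (@lt_le_trans _ _ 0%E) ?lte_fin//.
by apply: ereal_sup_ubound; left.
Qed.

End extremal_law.

(** * Paths of the limit and of the partial maxima *)

Section generated_sigma_algebra.
Context {R : realType} d (T : measurableType d) (P : probability T R).

Definition generators (F : set (T -> R)) : set_system T :=
  [set A | exists2 f, F f & preimage_set_system setT f measurable A].

Lemma measurable_generated (F : set (T -> R)) f : F f ->
  measurable_fun setT (f : g_sigma_algebraType (generators F) -> R).
Proof.
move=> Ff _ B mB; apply: sub_sigma_algebra; exists f => //.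
by exists B.
Qed.

Lemma independent_prob (F G : set (T -> R)) (A B : set T) : independent_families P F G ->
  measurable A -> measurable B ->
  measurable (A : set (g_sigma_algebraType (generators F))) ->
  measurable (B : set (g_sigma_algebraType (generators G))) ->
  prob P (A `&` B) = prob P A * prob P B.
Proof.
move=> ind mA mB gA gB; apply: EFin_inj; rewrite EFinM !probK//; first exact: ind.
exact: measurableI.
Qed.

End generated_sigma_algebra.

Section limit_path.
Context {R : realType}.

Lemma Dup_ofE (x : R -> R) : nondecreasing_cadlag x -> Dup_of x = x :> (R -> R).
Proof. by move=> xP; rewrite /Dup_of; case: pselect. Qed.

(** Right continuity lets a violation of monotonicity be moved to rational times;
    the right end point is itself rational. Countably many conditions make
    monotonicity a measurable event. *)
Lemma nondecreasing_cadlag_ratP (x : R -> R) :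
  (forall t, 0 <= t < 1 -> x s @[s --> t^'+] --> x t) ->
  (forall t, 0 < t <= 1 -> cvg (x s @[s --> t^'-])) ->
  nondecreasing_cadlag x <-> forall a b : rat, 0 <= (ratr a : R) -> (ratr a : R) <= ratr b ->
    (ratr b : R) <= 1 -> x (ratr a) <= x (ratr b).
Proof.
move=> xr xl; split=> [[xnd _ _] a b a0 ab b1|h].
  by apply: xnd; rewrite // in_itv/= ?a0 ?b1 ?(le_trans a0 ab) ?(le_trans ab b1).
split=> // s t; rewrite !in_itv/= => /andP[s0 s1] /andP[t0 t1].
rewrite le_eqVlt => /predU1P[->//|st]; rewrite leNgt; apply/negP => ts.
pose c := (x s + x t) / 2.
have c1 : x t < c by rewrite /c; lra.
have c2 : c < x s by rewrite /c; lra.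
have [a [a0 at_ ac]] : exists a : rat, [/\ 0 <= (ratr a : R), ratr a < t & c < x (ratr a)].
  have hs : \forall u \near s^'+, c < x u /\ u < t.
    near=> u; split; last by near: u; exact: nbhs_right_lt.
    by near: u; apply: (cvgr_gt (x s)) => //; apply: xr; rewrite s0 (lt_le_trans st).
  have [e /= e0 he] := hs.
  have /rat_in_itvoo[a] : s < s + e by rewrite ltrDl.
  rewrite in_itv/= => /andP[sa ase]; exists a.
  have [] := he (ratr a) _ sa; first by rewrite /= ltr_distlC; apply/andP; split; lra.
  by split=> //; rewrite (le_trans s0)// ltW.
have [b [b1 tb bc]] : exists b : rat, [/\ (ratr b : R) <= 1, t <= ratr b & x (ratr b) < c].
  move: t1; rewrite le_eqVlt => /predU1P[t1|t1].
    by exists 1; rewrite rmorph1 t1 lexx -t1.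
  have ht : \forall u \near t^'+, x u < c /\ u < 1.
    near=> u; split; last by near: u; exact: nbhs_right_lt.
    by near: u; apply: (cvgr_lt (x t)) => //; apply: xr; rewrite t0.
  have [e /= e0 he] := ht.
  have /rat_in_itvoo[b] : t < t + e by rewrite ltrDl.
  rewrite in_itv/= => /andP[tb bte]; exists b.
  have [] := he (ratr b) _ tb; first by rewrite /= ltr_distlC; apply/andP; split; lra.
  by move=> ? ?; split=> //; exact: ltW.
have := h a b a0 (le_trans (ltW at_) tb) b1; lra.
Unshelve. all: by end_near. Qed.

Context d (T : measurableType d) (W1 W2 : T -> Dup R) (C1 C2 : T -> R).

Definition limit_fun (w : T) (t : R) : R := Num.max (C1 w * W1 w t) (C2 w * W2 w t).

Lemma limit_fun_right w t : 0 <= t < 1 -> limit_fun w s @[s --> t^'+] --> limit_fun w t.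
Proof.
move=> t01; apply: cvg_maxr; apply: cvgM; try exact: cvg_cst.
- by have [_ fr _] := Dup_funP (W1 w); exact: fr.
- by have [_ fr _] := Dup_funP (W2 w); exact: fr.
Qed.

Lemma limit_fun_left w t : 0 < t <= 1 -> cvg (limit_fun w s @[s --> t^'-]).
Proof.
move=> t01; apply/cvg_ex.
have /cvg_ex[a xa] : cvg (W1 w s @[s --> t^'-]) by have [_ _ fl] := Dup_funP (W1 w); exact: fl.
have /cvg_ex[b xb] : cvg (W2 w s @[s --> t^'-]) by have [_ _ fl] := Dup_funP (W2 w); exact: fl.
by exists (Num.max (C1 w * a) (C2 w * b)); apply: cvg_maxr; apply: cvgM => //; exact: cvg_cst.
Qed.

Hypothesis mC1 : measurable_fun setT C1.
Hypothesis mC2 : measurable_fun setT C2.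
Hypothesis mW1 : forall t, 0 <= t <= 1 -> measurable_fun setT (fun w => W1 w t).
Hypothesis mW2 : forall t, 0 <= t <= 1 -> measurable_fun setT (fun w => W2 w t).

Lemma measurable_limit_fun t : 0 <= t <= 1 -> measurable_fun setT (limit_fun^~ t).
Proof.
by move=> t01; apply: measurable_maxr; apply: measurable_funM => //; [exact: mW1|exact: mW2].
Qed.

Let bigcapT_measurable_rat (F : rat -> set T) : (forall i, measurable (F i)) ->
  measurable (\bigcap_i F i).
Proof.
move=> mF; rewrite -[X in measurable X]setCK setC_bigcap; apply: measurableC.
by apply: bigcupT_measurable_rat => i; exact: measurableC.
Qed.

Lemma measurable_limit_monotone :
  measurable [set w | nondecreasing_cadlag (limit_fun w)].
Proof.
rewrite (_ : [set w | _] = \bigcap_a \bigcap_b [set w | 0 <= (ratr a : R) -> (ratr a : R) <= ratr b ->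
    (ratr b : R) <= 1 -> limit_fun w (ratr a) <= limit_fun w (ratr b)]).
  apply: bigcapT_measurable_rat => a; apply: bigcapT_measurable_rat => b.
  have [/andP[a0 /andP[ab b1]]|nab] := pselect [&& 0 <= (ratr a : R), (ratr a : R) <= ratr b & (ratr b : R) <= 1].
    rewrite (_ : [set w | _] = [set w | limit_fun w (ratr a) <= limit_fun w (ratr b)]).
      rewrite -[X in measurable X]setTI; apply: measurable_fun_ler => //.
        by apply: measurable_limit_fun; rewrite a0 (le_trans ab).
      by apply: measurable_limit_fun; rewrite b1 (le_trans a0).
    by apply/seteqP; split=> w /=; [apply|].
  rewrite (_ : [set w | _] = setT)//; apply/seteqP; split=> // w _ /= a0 ab b1.
  by exfalso; apply: nab; rewrite a0 ab b1.
apply/seteqP; split=> w /=.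
  by move=> /(nondecreasing_cadlag_ratP (@limit_fun_right w) (@limit_fun_left w)) h a _ b _; exact: h.
move=> h; apply/(nondecreasing_cadlag_ratP (@limit_fun_right w) (@limit_fun_left w)) => a b.
exact: h.
Qed.

(** The coefficients are nonnegative only almost surely, so the path may fail to
    be monotone on a null set, where the default path is used. *)
Lemma measurable_limit_path t : 0 <= t <= 1 ->
  measurable_fun setT (fun w => Dup_of (limit_fun w) t).
Proof.
move=> t01; pose S := [set w | nondecreasing_cadlag (limit_fun w)].
rewrite (_ : (fun w => _) = (fun w => limit_fun w t * \1_S w)).
  apply: measurable_funM; first exact: measurable_limit_fun.
  by apply: measurable_indic; exact: measurable_limit_monotone.
apply/funext => w; rewrite indicE /Dup_of; case: pselect => h.
  by rewrite mem_set// mulr1.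
by rewrite memNset// mulr0.
Qed.

End limit_path.

Section partial_maxima.
Context {R : realType}.

Lemma partial_maxE (a : R) (x : int -> R) n t : (0 < n)%N -> 0 <= t ->
  partial_max a x n t = a^-1 * running_max (x 1) (fun i => x i%:Z) (Num.truncn (n%:R * t)).
Proof.
move=> n_gt0 t0; have n0 : 0 < n%:R :> R by rewrite ltr0n.
rewrite /partial_max /running_max; case: ifPn => //; rewrite -ltNge => tn.
suff -> : Num.truncn (n%:R * t) = 0%N by rewrite big_geq// mulrC.
apply: truncn_def; rewrite mulr_ge0 ?(ltW n0)//=.
by rewrite mulrC -ltr_pdivlMr// mul1r.
Qed.

Lemma measurable_partial_max d (T : measurableType d) (a : R) (x : T -> int -> R) n t :
  (forall i, measurable_fun setT (x^~ i)) ->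
  measurable_fun setT (fun w => partial_max a (x w) n t).
Proof.
move=> mx; have [h|/negbTE h] := boolP (n%:R^-1 <= t).
  under eq_fun do rewrite /partial_max h.
  by apply: measurable_funM => //; exact: measurable_bigmax.
under eq_fun do rewrite /partial_max h.
exact: measurable_funM.
Qed.

End partial_maxima.

(** * Joint convergence of coefficients and extremes *)

Section max_of_products.
Context {R : realType}.

Lemma max_dist_lt (a b a' b' e : R) : `|a - a'| < e -> `|b - b'| < e ->
  `|Num.max a b - Num.max a' b'| < e.
Proof.
rewrite !ltr_norml => /andP[? ?] /andP[? ?]; apply/andP.
rewrite !maxEle; split; case: ifPn; case: ifPn; rewrite -?ltNge; lra.
Qed.

Lemma mul_dist_lt (K s a b a' b' : R) : 0 < K -> 0 < s -> s <= 1 ->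
  `|a'| <= K -> `|b'| <= K -> `|a - a'| < s -> `|b - b'| < s ->
  `|a * b - a' * b'| < (2 * K + 2) * s.
Proof.
move=> K0 s0 s1 aK bK as_ bs.
have -> : a * b - a' * b' = (a - a') * (b - b') + (a - a') * b' + a' * (b - b') by ring.
apply: (@le_lt_trans _ _ (s * s + s * K + K * s)); last by nra.
rewrite (le_trans (ler_normD _ _))// lerD//; last first.
  by rewrite normrM ler_pM// ltW.
rewrite (le_trans (ler_normD _ _))// lerD// normrM ler_pM//; exact: ltW.
Qed.

(** [inl true] and [inl false] index the positive and the negative extreme
    coefficient, [inr (inl _)] and [inr (inr _)] the grid values of the extremes
    that they multiply. *)
Definition coords (m : nat) : finType := (bool + ('I_m.+2 + 'I_m.+2))%type.

Definition combine (m : nat) (v : coords m -> R) (l : 'I_m.+2) : R :=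
  Num.max (v (inl true) * v (inr (inl l))) (v (inl false) * v (inr (inr l))).

Lemma box_open_combine m (O : set ('I_m.+2 -> R)) : box_open O ->
  box_open (@combine m @^-1` O).
Proof.
move=> oO v /oO[e e0 hO].
pose K := 1 + \sum_i `|v i|; have sK0 : 0 <= \sum_i `|v i| by exact: sumr_ge0.
have K0 : 0 < K by rewrite /K; lra.
have vK i : `|v i| <= K.
  by rewrite /K (bigD1 i)//= addrCA lerDl addr_ge0// sumr_ge0.
have K2 : 0 < 2 * K + 2 by lra.
(* coordinates bounded by [K] and moved by less than [s <= 1] change a product by
   less than [(2 * K + 2) * s] *)
pose s := Num.min 1 (e / (2 * K + 2)).
have s0 : 0 < s by rewrite lt_min ltr01 divr_gt0.
have s1 : s <= 1 by rewrite ge_min lexx.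
have sE : (2 * K + 2) * s <= e by rewrite mulrC -ler_pdivlMr// ge_min lexx orbT.
exists s => // u uv; apply: hO => l; apply: max_dist_lt;
  by apply: lt_le_trans sE; exact: mul_dist_lt.
Qed.

End max_of_products.

Section joint_vector.
Context {R : realType} d (T : measurableType d) (P : probability T R).
Context (alpha p r : R) (L : R -> R) (Z : int -> T -> R) (a : nat -> R).
Context (q : nat) (C : 'I_q.+1 -> T -> R).
Context d' (T' : measurableType d') (P' : probability T' R).
Context (W1 W2 : T' -> Dup R) (C1 C2 : T' -> R).
Hypothesis alpha_gt0 : 0 < alpha.
Hypothesis mZ : forall i, measurable_fun setT (Z i).
Hypothesis mC : forall j, measurable_fun setT (C j).
Hypothesis mC1 : measurable_fun setT C1.
Hypothesis mC2 : measurable_fun setT C2.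
Hypothesis Z_indep : mutually_independent P Z.
Hypothesis Z_ident : identically_distributed P Z.
Hypothesis L_slow : slowly_varying L.
Hypothesis Z_tail : forall x, 0 < x ->
  P [set w | x < `|Z 1 w|] = (x `^ (- alpha) * L x)%:E.
Hypotheses (p_ge0 : 0 <= p) (r_ge0 : 0 <= r).
Hypothesis Z_tail_p : fine (P [set w | x < Z 1 w]) /
  fine (P [set w | x < `|Z 1 w|]) @[x --> +oo] --> p.
Hypothesis Z_tail_r : fine (P [set w | Z 1 w < - x]) /
  fine (P [set w | x < `|Z 1 w|]) @[x --> +oo] --> r.
Hypothesis a_gt0 : forall n, 0 < a n.
Hypothesis a_norm : n%:R * fine (P [set w | a n < `|Z 1 w|]) @[n --> \oo] --> (1 : R).
Hypothesis CZ_indep : independent_families P (range C) (range Z).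
Hypothesis W1_extremal : extremal_process P' (power_measure p alpha) W1.
Hypothesis W2_extremal : extremal_process P' (power_measure r alpha) W2.
Hypothesis W_indep : independent_families P' (coordinates W1) (coordinates W2).
Hypothesis C12_indep : independent_families P'
  [set f : T' -> R | f = C1 \/ f = C2] (coordinates W1 `|` coordinates W2).
Hypothesis C12_law : forall B : set (R * R), measurable B ->
  P' [set w | B (C1 w, C2 w)] = P [set w | B (pos_coef (C^~ w), neg_coef (C^~ w))].

Let mW1 t : 0 <= t <= 1 -> measurable_fun setT (fun w => W1 w t).
Proof. by case: W1_extremal => + _; apply. Qed.

Let mW2 t : 0 <= t <= 1 -> measurable_fun setT (fun w => W2 w t).
Proof. by case: W2_extremal => + _; apply. Qed.

Variable m : nat.

Definition sample_vector (n : nat) (w : T) (i : coords m) : R :=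
  match i with
  | inl true => pos_coef (C^~ w)
  | inl false => neg_coef (C^~ w)
  | inr (inl l) => scaled_pos Z a n (@block_end R m n l) w
  | inr (inr l) => scaled_neg Z a n (@block_end R m n l) w
  end.

Definition limit_vector (w : T') (i : coords m) : R :=
  match i with
  | inl true => C1 w
  | inl false => C2 w
  | inr (inl l) => W1 w (grid l)
  | inr (inr l) => W2 w (grid l)
  end.

Lemma measurable_sample_vector n i : measurable_fun setT (fun w => sample_vector n w i).
Proof.
case: i => [[]|[l|l]] /=; [exact: measurable_pos_coef|exact: measurable_neg_coef|
  exact: measurable_scaled_pos|exact: measurable_scaled_neg].
Qed.

Lemma measurable_limit_vector i : measurable_fun setT (fun w => limit_vector w i).
Proof. by case: i => [[]|[l|l]] //=; [apply: mW1|apply: mW2]; exact: grid01. Qed.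

Let sample_extremes n (x y : 'I_m.+2 -> R) : set T :=
  [set w | forall l : 'I_m.+2, scaled_pos Z a n (@block_end R m n l) w <= x l /\
                              scaled_neg Z a n (@block_end R m n l) w <= y l].

Let sample_coefs (z1 z2 : R) : set T :=
  [set w | pos_coef (C^~ w) <= z1 /\ neg_coef (C^~ w) <= z2].

Lemma measurable_le_set e (S : measurableType e) (f : S -> R) (c : R) :
  measurable_fun setT f -> measurable [set w | f w <= c].
Proof.
move=> mf; rewrite (_ : [set w | _] = setT `&` f @^-1` `]-oo, c]%classic); first exact: mf.
by apply/seteqP; split=> w; rewrite /= in_itv/= => // -[].
Qed.

Lemma measurable_le_pair e (S : measurableType e) (f g : S -> R) (c1 c2 : R) :
  measurable_fun setT f -> measurable_fun setT g ->
  measurable [set w | f w <= c1 /\ g w <= c2].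
Proof.
move=> mf mg.
rewrite (_ : [set w | _] = [set w | f w <= c1] `&` [set w | g w <= c2])//.
by apply: measurableI; exact: measurable_le_set.
Qed.

Lemma measurable_forall_grid e (S : measurableType e) (f : 'I_m.+2 -> S -> R) (x : 'I_m.+2 -> R) :
  (forall l, measurable_fun setT (f l)) -> measurable [set w | forall l, f l w <= x l].
Proof.
move=> mf; rewrite (_ : [set w | _] = \bigcap_(l in [set: 'I_m.+2]) [set w | f l w <= x l]).
  apply: fin_bigcap_measurable => [|l _]; first exact: finite_finset.
  exact: measurable_le_set.
by apply/seteqP; split=> w h l; [move=> _; exact: h|exact: h].
Qed.

Lemma prob_sample_vector n (z : coords m -> R) :
  prob P (sample_vector n @^-1` orthant z) =
  prob P (sample_coefs (z (inl true)) (z (inl false))) *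
  prob P (sample_extremes n (fun l => z (inr (inl l))) (fun l => z (inr (inr l)))).
Proof.
have mext e (S : measurableType e) (f g : 'I_m.+2 -> S -> R) (x y : 'I_m.+2 -> R) :
    (forall l, measurable_fun setT (f l)) -> (forall l, measurable_fun setT (g l)) ->
    measurable [set w | forall l, f l w <= x l /\ g l w <= y l].
  move=> mf mg; rewrite (_ : [set w | _] =
      [set w | forall l, f l w <= x l] `&` [set w | forall l, g l w <= y l]).
    by apply: measurableI; exact: measurable_forall_grid.
  apply/seteqP; split=> w /=; first by move=> h; split=> l; case: (h l).
  by move=> [h1 h2] l; split.
rewrite -(independent_prob CZ_indep); last 4 first.
- by apply: measurable_le_pair; [exact: measurable_pos_coef|exact: measurable_neg_coef].
- by apply: mext => l; [exact: measurable_scaled_pos|exact: measurable_scaled_neg].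
- have mC' j : measurable_fun setT (C j : g_sigma_algebraType (generators (range C)) -> R).
    by apply: measurable_generated; exists j.
  by apply: measurable_le_pair; [exact: (measurable_pos_coef mC')|exact: (measurable_neg_coef mC')].
- have mZ' j : measurable_fun setT (Z j : g_sigma_algebraType (generators (range Z)) -> R).
    by apply: measurable_generated; exists j.
  by apply: mext => l; [exact: (measurable_scaled_pos mZ')|exact: (measurable_scaled_neg mZ')].
congr (prob P _); apply/seteqP; split=> w /=.
  move=> h; split; first by split; [exact: (h (inl true))|exact: (h (inl false))].
  by move=> l; split; [exact: (h (inr (inl l)))|exact: (h (inr (inr l)))].
by move=> [[h1 h2] h] [[]|[l|l]] //=; case: (h l).
Qed.

Let limit_coefs (z1 z2 : R) : set T' := [set w | C1 w <= z1 /\ C2 w <= z2].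

Lemma prob_limit_vector (z : coords m -> R) :
  prob P' (limit_vector @^-1` orthant z) =
  prob P' (limit_coefs (z (inl true)) (z (inl false))) *
  (prob P' [set w | forall l : 'I_m.+2, W1 w (grid l) <= z (inr (inl l))] *
   prob P' [set w | forall l : 'I_m.+2, W2 w (grid l) <= z (inr (inr l))]).
Proof.
have mV1 : measurable [set w | forall l : 'I_m.+2, W1 w (grid l) <= z (inr (inl l))].
  by apply: (@measurable_forall_grid _ _ (fun l w => W1 w (grid l))) => l; apply: mW1; exact: grid01.
have mV2 : measurable [set w | forall l : 'I_m.+2, W2 w (grid l) <= z (inr (inr l))].
  by apply: (@measurable_forall_grid _ _ (fun l w => W2 w (grid l))) => l; apply: mW2; exact: grid01.
have genW (W : T' -> Dup R) (F : set (T' -> R)) (x : 'I_m.+2 -> R) : coordinates W `<=` F ->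
    measurable ([set w | forall l : 'I_m.+2, W w (grid l) <= x l]
      : set (g_sigma_algebraType (generators F))).
  move=> WF; apply: (@measurable_forall_grid _ _
    (fun l (w : g_sigma_algebraType (generators F)) => W w (grid l))) => l.
  by apply: measurable_generated; apply: WF; exists (grid l) => //; exact: grid01.
rewrite -(independent_prob W_indep)//; [|exact: genW|exact: genW].
rewrite -(independent_prob C12_indep).
- congr (prob P' _); apply/seteqP; split=> w /=.
    move=> h; split; first by split; [exact: (h (inl true))|exact: (h (inl false))].
    by split=> l; [exact: (h (inr (inl l)))|exact: (h (inr (inr l)))].
  by move=> [[h1 h2] [h3 h4]] [[]|[l|l]] //=.
- exact: measurable_le_pair.
- exact: measurableI.
- by apply: measurable_le_pair; apply: measurable_generated; [left|right].
- by apply: measurableI; apply: genW => f Wf; [left|right].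
Qed.

Let prob_coefs (z1 z2 : R) : prob P' (limit_coefs z1 z2) = prob P (sample_coefs z1 z2).
Proof.
have mB : measurable (`]-oo, z1]%classic `*` `]-oo, z2]%classic : set (R * R)).
  by apply: measurableX; exact: measurable_itv.
rewrite /prob; congr fine; have := C12_law mB.
rewrite (_ : [set w | _] = limit_coefs z1 z2); last first.
  by apply/seteqP; split=> w /=; rewrite !in_itv.
by move=> ->; congr (P _); apply/seteqP; split=> w /=; rewrite !in_itv.
Qed.

(** The coefficient factor does not depend on [n]. A negative level makes both
    sides vanish, the extremes being nonnegative; for positive levels the limit
    of the extremes is the product of the distribution functions of the two
    extremal processes. *)
Lemma sample_vector_cdf (z : coords m -> R) : (forall i, z i != 0) ->
  prob P (sample_vector n @^-1` orthant z) @[n --> \oo] -->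
  prob P' (limit_vector @^-1` orthant z).
Proof.
move=> z0; rewrite prob_limit_vector prob_coefs.
under eq_fun do rewrite prob_sample_vector.
apply: cvgM; first exact: cvg_cst.
pose x l := z (inr (inl l)); pose y l := z (inr (inr l)).
have pos0 n l w : 0 <= scaled_pos Z a n (@block_end R m n l) w.
  by rewrite mulr_ge0 ?invr_ge0 ?(ltW (a_gt0 n))//; exact: running_max_ge0.
have neg0 n l w : 0 <= scaled_neg Z a n (@block_end R m n l) w.
  by rewrite mulr_ge0 ?invr_ge0 ?(ltW (a_gt0 n))//; exact: running_max_ge0.
have [[l xl]|x_ge] := pselect (exists l, x l < 0).
  rewrite (extremal_cdf0 W1_extremal xl) mul0r.
  under eq_fun => n.
    rewrite (_ : sample_extremes _ _ _ = set0) ?prob0; first over.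
    apply/seteqP; split=> w //= /(_ l)[+ _]; apply/negP; rewrite -ltNge.
    exact: lt_le_trans xl (pos0 _ _ _).
  exact: cvg_cst.
have [[l yl]|y_ge] := pselect (exists l, y l < 0).
  rewrite (extremal_cdf0 W2_extremal yl) mulr0.
  under eq_fun => n.
    rewrite (_ : sample_extremes _ _ _ = set0) ?prob0; first over.
    apply/seteqP; split=> w //= /(_ l)[_]; apply/negP; rewrite -ltNge.
    exact: lt_le_trans yl (neg0 _ _ _).
  exact: cvg_cst.
have x0 l : 0 < x l.
  by rewrite lt_neqAle eq_sym z0/= leNgt; apply/negP => h; apply: x_ge; exists l.
have y0 l : 0 < y l.
  by rewrite lt_neqAle eq_sym z0/= leNgt; apply/negP => h; apply: y_ge; exists l.
rewrite (extremal_cdf W1_extremal p_ge0 alpha_gt0 x0).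
rewrite (extremal_cdf W2_extremal r_ge0 alpha_gt0 y0).
rewrite -big_split/= (eq_bigr (fun l : 'I_m.+1 => expR (- (m.+1%:R^-1 *
     (p * suffix_min x l.+1 `^ (- alpha) + r * suffix_min y l.+1 `^ (- alpha)))))).
  exact: (prob_extremes_cvg mZ Z_indep Z_ident L_slow Z_tail a_gt0 a_norm Z_tail_p Z_tail_r x0 y0).
by move=> l _; rewrite -expRD mulrDr opprD.
Qed.

(** Nonnegativity is inherited from the law of the extreme coefficients. *)
Let C_ge0_as : prob P' [set w | ~ (0 <= C1 w /\ 0 <= C2 w)] = 0.
Proof.
have mB : measurable (~` (`[0, +oo[%classic `*` `[0, +oo[%classic) : set (R * R)).
  by apply: measurableC; apply: measurableX; exact: measurable_itv.
rewrite (_ : [set w | _] = [set w | (~` (`[0, +oo[%classic `*` `[0, +oo[%classic)) (C1 w, C2 w)]).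
  rewrite /prob (C12_law mB) (_ : [set w | _] = set0) ?measure0//.
  apply/seteqP; split=> w //=; apply; rewrite !in_itv/= !andbT.
  by split; [exact: pos_coef_ge0|exact: neg_coef_ge0].
by apply/seteqP; split=> w /=; rewrite !in_itv/= !andbT.
Qed.

(** The coefficients and extremes are combined by a continuous map, under which
    preimages of open sets are open; the almost sure sign of the limiting
    coefficients identifies the grid values of the limit path with the combined
    vector. *)
Lemma decoupled_liminf (O : set ('I_m.+2 -> R)) (e : R) : box_open O -> 0 < e ->
  \forall n \near \oo,
    prob P' ((fun w => @grid_values R m (Dup_of (limit_fun W1 W2 C1 C2 w))) @^-1` O) - e <
    prob P ((fun w l => decoupled_max Z C a n (@block_end R m n l) w) @^-1` O).
Proof.
move=> oO e0.
have := prob_box_open_liminf measurable_sample_vector measurable_limit_vector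
  sample_vector_cdf (box_open_combine oO) e0.
apply: filterS => n hn; rewrite (le_lt_trans _ hn)// lerD2r.
have mlim : measurable (limit_vector @^-1` (@combine R m @^-1` O)).
  by apply: measurable_box_open; [exact: measurable_limit_vector|exact: box_open_combine].
have mneg : measurable [set w | ~ (0 <= C1 w /\ 0 <= C2 w)].
  apply: measurableC; rewrite (_ : (fun w => _) = [set w | - C1 w <= 0] `&` [set w | - C2 w <= 0]).
    by apply: measurableI; apply: measurable_le_set; exact: measurableT_comp.
  by apply/seteqP; split=> w /=; rewrite !oppr_le0.
apply: (@le_trans _ _ (prob P' (limit_vector @^-1` (@combine R m @^-1` O) `|`
    [set w | ~ (0 <= C1 w /\ 0 <= C2 w)]))); last first.
  by rewrite (le_trans (prob_leU _ mlim mneg))// C_ge0_as addr0.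
apply: prob_le.
- apply: measurable_box_open => // l; apply: measurable_limit_path => //; exact: grid01.
- exact: measurableU.
- move=> w; rewrite /preimage/= => Ow.
  have [[c1 c2]|nc] := pselect (0 <= C1 w /\ 0 <= C2 w); [left|by right].
  move: Ow; rewrite /grid_values Dup_ofE//.
  exact: nondecreasing_cadlag_max.
Qed.

End joint_vector.

(** * Convergence of the partial maxima *)

Theorem theorem3p3 (R : realType)
  (d : measure_display) (T : measurableType d) (P : probability T R)
  (alpha p r : R) (L : R -> R) (Z : int -> {RV P >-> R}) (a : nat -> R)
  (q : nat) (C : 'I_q.+1 -> {RV P >-> R})
  (d' : measure_display) (T' : measurableType d') (P' : probability T' R)
  (W1 W2 : T' -> Dup R) (C1 C2 : {RV P' >-> R})
  (alpha_gt0 : 0 < alpha)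
  (Z_indep : mutually_independent P (fun i => Z i : T -> R))
  (Z_ident : identically_distributed P (fun i => Z i : T -> R))
  (L_slow : slowly_varying L)
  (Z_tail : forall x, 0 < x ->
     P [set w | x < `|Z 1 w|] = (x `^ (- alpha) * L x)%:E)
  (p01 : 0 <= p <= 1) (pr1 : p + r = 1)
  (Z_tail_p : fine (P [set w | x < Z 1 w]) /
     fine (P [set w | x < `|Z 1 w|]) @[x --> +oo] --> p)
  (Z_tail_r : fine (P [set w | Z 1 w < - x]) /
     fine (P [set w | x < `|Z 1 w|]) @[x --> +oo] --> r)
  (a_gt0 : forall n, 0 < a n)
  (a_norm : n%:R * fine (P [set w | a n < `|Z 1 w|]) @[n --> \oo] --> (1 : R))
  (CZ_indep : independent_families P
     (range (fun j => C j : T -> R)) (range (fun i => Z i : T -> R)))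
  (W1_extremal : extremal_process P' (power_measure p alpha) W1)
  (W2_extremal : extremal_process P' (power_measure r alpha) W2)
  (W_indep : independent_families P' (coordinates W1) (coordinates W2))
  (C12_indep : independent_families P'
     [set f : T' -> R | f = C1 \/ f = C2] (coordinates W1 `|` coordinates W2))
  (C12_law : forall B : set (R * R), measurable B ->
     P' [set w | B (C1 w, C2 w)] =
     P [set w | B (\big[Num.max/0]_(j < q.+1) Num.max (C j w) 0,
                   \big[Num.max/0]_(j < q.+1) Num.max (- C j w) 0)]) :
  cvg_in_distribution P P'
    (fun n w => Dup_of (partial_max (a n)
       (fun t => linear_process (fun j => C j : T -> R)
                                (fun i => Z i : T -> R) t w) n))
    (fun w => Dup_of (fun t => Num.max (C1 w * W1 w t) (C2 w * W2 w t))).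
Proof.
have [p_ge0 r_ge0] : 0 <= p /\ 0 <= r by lra.
pose Zf i : T -> R := Z i; pose Cf j : T -> R := C j.
have mZ i : measurable_fun setT (Zf i) by exact: measurable_funPT.
have mC j : measurable_fun setT (Cf j) by exact: measurable_funPT.
have mC1 : measurable_fun setT C1 by exact: measurable_funPT.
have mC2 : measurable_fun setT C2 by exact: measurable_funPT.
pose X n w : Dup R := Dup_of (partial_max (a n) (moving_sum (Cf^~ w) (Zf^~ w)) n).
pose Y w : Dup R := Dup_of (limit_fun W1 W2 C1 C2 w).
have mW1 t : 0 <= t <= 1 -> measurable_fun setT (fun w => W1 w t).
  by case: W1_extremal => + _; apply.
have mW2 t : 0 <= t <= 1 -> measurable_fun setT (fun w => W2 w t).
  by case: W2_extremal => + _; apply.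
have XE n w t : X n w t = partial_max (a n) (moving_sum (Cf^~ w) (Zf^~ w)) n t.
  by rewrite /X Dup_ofE//; exact: nondecreasing_cadlag_partial_max.
have mX n t : 0 <= t <= 1 -> measurable_fun setT (fun w => X n w t).
  move=> _; under eq_fun do rewrite XE.
  by apply: measurable_partial_max => i; exact: measurable_moving_sum.
have mY t : 0 <= t <= 1 -> measurable_fun setT (fun w => Y w t).
  by move=> t01; exact: measurable_limit_path.
have rX n : random_element (X n) by exact: random_element_Dup (mX n).
have rY : random_element Y by exact: random_element_Dup.
split=> // f cf [K fK]; apply: (cvg_expectation_open rX rY _ cf fK) => U oU e e0.
pose V m n w (l : 'I_m.+2) := decoupled_max Zf Cf a n (@block_end R m n l) w.
apply: (M1_open_liminf (V := V)) => //.
- by move=> m n l; exact: measurable_decoupled_max.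
- move=> m G e' oG e'0.
  exact: (decoupled_liminf alpha_gt0 mZ mC mC1 mC2 Z_indep Z_ident L_slow Z_tail
    p_ge0 r_ge0 Z_tail_p Z_tail_r a_gt0 a_norm CZ_indep W1_extremal W2_extremal
    W_indep C12_indep C12_law oG e'0).
- move=> m h h0.
  have H := scaled_max_approx mZ mC Z_indep Z_ident L_slow Z_tail a_gt0 a_norm
    (N := fun n (l : 'I_m.+2) => @block_end R m n l) (fun n l => @block_end_le R m n l) h0.
  apply: cvg_trans H; apply: near_eq_cvg; near=> n.
  have n0 : (0 < n)%N by near: n; exact: nbhs_infty_gt.
  congr (prob P _); apply/seteqP; split=> w /= [l hl]; exists l; move: hl;
    by rewrite XE partial_maxE//; have /andP[] := @grid01 R m l.
Unshelve. all: by end_near. Qed.
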